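(* Let $n$ be a positive integer and let $\ell$ be an integer with $\lceil n/2\rceil\le \ell\le n$. \begin{enumerate} \item[(a)] The set $$\Big\{\tbinom{n}{k}\big(a^{\otimes k}\otimes(a^c)^{\otimes(n-k)}\big)^\vee e^{(n)}_{\ell,\mathbb{H}}\ :\ k\in\{n-\ell,\ldots,\ell\}\Big\}$$ is a complete set of $2\ell-n+1$ primitive orthogonal idempotents in $\mathbb{S}_\ell^{(n)}\mathbb{H}\otimes_\mathbb{R}\mathbb{C}$. \item[(b)] If $n$ is odd, then the elements $$\binom{n}{k}\frac{n-2k}{2^k}\sum_{i=0}^{\frac{n-1}{2}-k}\Big(-\frac12\Big)^i\frac{\binom{n-2k-i}{i}}{n-2k-i}\big(1^{\otimes(n-2k-2i)}\otimes\square^{\otimes(k+i)}\big)^\vee\cdot e^{(n)}_{\ell,\mathbb{H}},$$ for $k\in\{n-\ell,\ldots,\frac{n-1}{2}\}$, form a complete set of $\frac{2\ell-n+1}{2}$ primitive orthogonal idempotents in $\mathbb{S}_\ell^{(n)}\mathbb{H}$. \item[(c)] If $n$ is even, then the element $\big(\tfrac12\big)^{n/2}\binom{n}{n/2}\big(\square^{\otimes \frac n2}\big)^\vee\cdot e^{(n)}_{\ell,\mathbb{H}}$ together with the elements $$\binom{n}{k}\frac{\frac n2-k}{2^k}\sum_{i=0}^{\lfloor \frac n4-\frac k2\rfloor}\Big(-\frac14\Big)^i\frac{\binom{\frac n2-k-i}{i}}{\frac n2-k-i}\big(\square^{\otimes(k+2i)}\otimes(1\otimes1-\square)^{\otimes(\frac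 n2-k-2i)}\big)^\vee\cdot\frac12\big(1^{\otimes n}+\delta\, e_2^{\otimes n}\big)\cdot e^{(n)}_{\ell,\mathbb{H}},$$ for $k\in\{n-\ell,\ldots,\frac n2-1\}$ and $\delta\in\{-1,1\}$, form a complete set of $2\ell-n+1$ primitive orthogonal idempotents in $\mathbb{S}_\ell^{(n)}\mathbb{H}$. \end{enumerate}
   Context: $\mathbb{H}$ is the real quaternion algebra with basis $e_0=1,e_1,e_2,e_3$, $e_1^2=e_2^2=e_3^2=-1$, $e_1e_2=-e_2e_1=e_3$, $e_2e_3=-e_3e_2=e_1$, $e_3e_1=-e_1e_3=e_2$; $\mathbb{R}[e_1]$ is the subalgebra spanned by $1,e_1$. For $F\in\{\mathbb{R},\mathbb{C}\}$ let $\mathbb{H}_F=\mathbb{H}\otimes_\mathbb{R}F$, and let $\mathbb{H}_F^{\otimes n}$ be the $n$-fold tensor power over $F$ with componentwise multiplication $(x_1\otimes\cdots\otimes x_n)(y_1\otimes\cdots\otimes y_n)=x_1y_1\otimes\cdots\otimes x_ny_n$. The symmetric group $\mathfrak S_n$ acts by $\sigma(x_1\otimes\cdots\otimes x_n)=x_{\sigma^{-1}(1)}\otimes\cdots\otimes x_{\sigma^{-1}(n)}$; for $x\in\mathbb{H}_F^{\otimes n}$ put $x^\vee=\frac1{n!}\sum_{\sigma\in\mathfrak S_n}\sigma(x)$. $\mathrm{Sym}^n\mathbb{H}_F$ is the subalgebra of $\mathfrak S_n$-fixed tensors, and $\mathrm{Sym}^n\mathbb{H}_\mathbb{C}=\mathrm{Sym}^n\mathbb{H}\otimes_\mathbb{R}\mathbb{C}$.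 Let $\triangle_\mathbb{H}=\frac14\sum_{i=0}^3 e_i\otimes e_i$, and for $n\ge2$ let $\triangle^{(n)}_\mathbb{H}=(\triangle_\mathbb{H}\otimes1^{\otimes(n-2)})^\vee$ (a central element of $\mathrm{Sym}^n\mathbb{H}_F$). For integers $\lceil n/2\rceil\le m\le n$ let $\beta^{(n)}_{m}=\frac{2(n-m)(2m+2)}{4n(n-1)}$ and $$e^{(n)}_{m,\mathbb{H}}=\prod_{\lceil n/2\rceil\le m'\le n,\ m'\neq m}\frac{\triangle^{(n)}_\mathbb{H}-\beta^{(n)}_{m'}1^{\otimes n}}{\beta^{(n)}_{m}-\beta^{(n)}_{m'}}\quad(n\ge2),\qquad e^{(1)}_{1,\mathbb{H}}=1.$$ These are orthogonal central idempotents of $\mathrm{Sym}^n\mathbb{H}_F$ summing to $1^{\otimes n}$. Put $\mathbb{S}^{(n)}_\ell\mathbb{H}_F=\mathrm{Sym}^n\mathbb{H}_F\cdot e^{(n)}_{\ell,\mathbb{H}}$, a ring with unit $e^{(n)}_{\ell,\mathbb{H}}$; $\mathbb{S}^{(n)}_\ell\mathbb{H}\otimes_\mathbb{R}\mathbb{C}=\mathbb{S}^{(n)}_\ell\mathbb{H}_\mathbb{C}$. Let $a=\frac12(1+\sqrt{-1}e_1)$, $a^c=\frac12(1-\sqrt{-1}e_1)\in\mathbb{H}_\mathbb{C}$, and $\square=\frac12(1\otimes1+e_1\otimes e_1)\in\mathrm{Sym}^2\mathbb{H}$. Tensor products of symmetric tensors such as $\square^{\otimes j}\otimes 1^{\otimes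 r}$ are viewed in $\mathbb{H}_F^{\otimes n}$ before applying $^\vee$. In a unital associative ring $R$: an idempotent is $x$ with $x^2=x$; idempotents $\{x_i\}$ are orthogonal if $x_ix_j=0$ for $i\neq j$; a nonzero idempotent is primitive if it is not a sum of two nonzero orthogonal idempotents; a set of orthogonal idempotents is complete if they sum to $1_R$. *)

(* Defs.v *)
From HB Require Import structures.
From mathcomp Require Import all_boot all_order all_algebra.
From mathcomp Require Import fingroup perm.
From mathcomp Require Import reals.
From mathcomp Require Export complex.
Set Implicit Arguments. Unset Strict Implicit. Unset Printing Implicit Defensive.
Import Order.TTheory GRing.Theory Num.Theory.
Local Open Scope ring_scope.

Section Quat.
Variable K : fieldType.

(* Quaternions over K (H_K = H (x)_R K): coordinates in the basis e_0..e_3. *)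
Definition quat := {ffun 'I_4 -> K^o}.

Definition qe (i : 'I_4) : quat := [ffun j => (j == i)%:R].

Definition qmul_basis (i j : nat) : bool * nat :=
  (* (negative?, index) *)
  match i, j with
  | 0, j => (false, j)
  | i, 0 => (false, i)
  | 1, 1 | 2, 2 | 3, 3 => (true, 0)
  | 1, 2 => (false, 3) | 2, 1 => (true, 3)
  | 2, 3 => (false, 1) | 3, 2 => (true, 1)
  | 3, 1 => (false, 2) | 1, 3 => (true, 2)
  | _, _ => (false, 0)
  end.

Definition qc (i j k : 'I_4) : K :=
  let: (neg, r) := qmul_basis i j in
  if r == k then (if neg then -1 else 1) else 0.

(* words indexing the basis e_(w 0) (x) ... (x) e_(w (n-1)) of H_K^(x)n *)
Definition word n := {ffun 'I_n -> 'I_4}.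

(* elements of H_K^(x)n, as coordinate functions on basis tensors *)
Definition tens n := {ffun word n -> K^o}.

Definition tmul n (x y : tens n) : tens n :=
  [ffun w : word n => \sum_(u : word n) \sum_(v : word n)
      x u * y v * \prod_(m < n) qc (u m) (v m) (w m)].

Definition ptens n (f : nat -> quat) : tens n :=
  [ffun w : word n => \prod_(m < n) f m (w m)].

Definition tone n : tens n := ptens n (fun _ => qe 0).

(* letter at nat position j of a word (e_0 outside the range) *)
Definition wat n (w : word n) (j : nat) : 'I_4 :=
  if insub j is Some i then w i else ord0.

Definition subw n (w : word n) (s len : nat) : word len :=
  [ffun i : 'I_len => wat w (s + i)].

(* tensor product x (x) y of x in H^(x)m and y in H^(x)p, viewed in H^(x)n
   (it is 0 unless m + p = n, which is always the case where it is used) *)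
Definition ttens {n m p} (x : tens m) (y : tens p) : tens n :=
  [ffun w : word n => if m + p == n then x (subw w 0 m) * y (subw w m p) else 0].

(* x^(x)j viewed in H^(x)L, for x in H^(x)m (0 unless L = j * m) *)
Fixpoint tpow m (x : tens m) (j L : nat) : tens L :=
  match j with
  | 0 => [ffun _ => (L == 0)%:R]
  | j'.+1 => ttens x (tpow x j' (L - m))
  end.

(* action of the symmetric group: sigma(x_1 (x) ... (x) x_n)
   = x_(sigma^-1 1) (x) ... (x) x_(sigma^-1 n) *)
Definition tperm n (s : {perm 'I_n}) (x : tens n) : tens n :=
  [ffun w : word n => x [ffun m => w (s m)]].

Definition sym n (x : tens n) : tens n :=
  (n`!%:R)^-1 *: \sum_(s : {perm 'I_n}) tperm s x.

Definition is_sym n (x : tens n) := forall s : {perm 'I_n}, tperm s x = x.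

Definition tdelta : tens 2 := 4^-1 *: \sum_(i < 4) ptens 2 (fun _ => qe i).

Definition tdeltan n : tens n := sym (ttens tdelta (tone (n - 2))).

Definition beta (n m : nat) : K :=
  (2 * (n - m) * (2 * m + 2))%:R / (4 * n * (n - 1))%:R.

Definition eid n m : tens n :=
  if (n < 2)%N then tone n else
  \big[@tmul n / tone n]_(uphalf n <= m' < n.+1 | m' != m)
     ((beta n m - beta n m')^-1 *: (tdeltan n - beta n m' *: tone n)).

Definition tsq : tens 2 := 2^-1 *: (ptens 2 (fun _ => qe 0) + ptens 2 (fun _ => qe 1)).

Definition inS n l (x : tens n) := exists s : tens n, is_sym s /\ x = tmul s (eid n l).

Definition idem n (x : tens n) := tmul x x = x.

Definition prim_idem n l (x : tens n) :=
  [/\ inS l x, idem x, x <> 0 &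
   ~ exists y z : tens n, [/\ inS l y /\ inS l z, idem y /\ idem z,
        y <> 0 /\ z <> 0, tmul y z = 0 /\ tmul z y = 0 & x = y + z]].

(* the family (f i)_(i in I) is a complete set of (#I distinct) primitive
   orthogonal idempotents of the ring S^(n)_l H_K (unit e^(n)_(l,H)) *)
Definition complete_poi n l (J : eqType) (I : seq J) (f : J -> tens n) :=
  [/\ uniq I, {in I &, injective f},
      {in I, forall i, prim_idem l (f i)},
      {in I &, forall i j, i != j -> tmul (f i) (f j) = 0} &
      \sum_(i <- I) f i = eid n l].

End Quat.

Arguments qe {K}.
Arguments tone {K}.
Arguments ptens {K}.
Arguments tdelta {K}.
Arguments tsq {K}.
Arguments eid {K}.

Definition qa (R : realType) : quat R[i] := 2^-1 *: (qe 0 + Complex 0 1 *: qe 1).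
Definition qac (R : realType) : quat R[i] := 2^-1 *: (qe 0 - Complex 0 1 *: qe 1).

(* Main.v *)
Require Import Defs.
From HB Require Import structures.
From mathcomp Require Import all_boot all_order all_algebra.
From mathcomp Require Import fingroup perm.
From mathcomp Require Import reals complex.
From mathcomp Require Import ring zify ssrAC.
Set Implicit Arguments. Unset Strict Implicit. Unset Printing Implicit Defensive.
Import Order.TTheory GRing.Theory Num.Theory.
Local Open Scope ring_scope.

(* Over C, the elements a and a^c are the diagonal matrix units of H_C = M_2(C).  The sums
   D x = sum_m 1 (x) .. (x) x (x) .. (x) 1 (x in slot m) over the slots, taken for the two
   off-diagonal units, give operators E and F which together with D a span a copy of gl2 in
   Sym^n H_C; Om = n(n-1) Delta^(n) is its Casimir element, and the elements
   P_k = 'C(n,k) (a^k (x) (a^c)^(n-k))^v are its weight projections.  On P_k one has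
   F E = om_k - Om and E F = om_(n-k) - Om, where om_k = (n-k)(k+1) = n(n-1) beta_k.
   Climbing the ladder gives prod_(m >= k) (Om - om_m) P_k = 0, whence e_l P_k = 0 unless
   n-l <= k <= l, and the highest weight vector
   prod_(i < n-l) (F_(2i) - F_(2i+1)) a^(x)n shows e_l P_k <> 0 otherwise.
   Sym^n H_C is generated by the D x, so P_j Sym^n P_k consists of polynomials in Om times a
   power of E or F; hence e_l P_k Sym^n P_k = C e_l P_k, which is the primitivity in (a).

   Recording a word with k letters a and n-k letters a^c by 'X^k turns 1 into 1 + 'X, the
   square into 2 'X, and Waring's formula for 'X^N + 1 identifies the sums in (b) and (c)
   with P_k + P_(n-k).  The element J = e_2^(x)n exchanges P_k and P_(n-k), and
   J^2 = (-1)^n.  For n even, (1 + J)/2 and (1 - J)/2 cut the corner of P_k + P_(n-k) down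
   to dimension one; for n odd, the real points of that corner form a quaternion division
   algebra, whose only idempotents are 0 and 1. *)

(** * Tensor powers of the quaternion algebra *)

(** The eigenvalues dictate the range of l. Since om_k = om_(n-1-k), Om cannot tell k from its
    mirror image n-1-k, so only the indices from n/2 upwards serve as nodes of the interpolation
    that defines e_l. They are enough because a weight may climb with E or descend with F, and one
    of the two ladders ends after at most n/2 steps. The mirror image also sets the surviving
    weights: descending from weight l stops just above n-1-l, where the factor om_k - om_l vanishes.
    No classification of modules and no dimension count enters: primitivity comes from
    one-dimensional corners, completeness from vanishing outside n-l..l, and only nonvanishing needs
    an explicit vector. The descent to the reals depends on the parity. For n even the elements of
    (c) are already primitive over C, so a real splitting would give a complex one. For n odd P_k +
    P_(n-k) splits over C, and conjugation must intervene: an idempotent fixed by it is given by two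
    numbers alpha and b, and J^2 = -1 turns idempotency with b nonzero into |alpha|^2 + |b|^2 =
    0. *)

Section StructureConstants.
Variables (K : fieldType) (B : finType) (c : B -> B -> B -> K).

(** Both H (with [qc]) and its tensor power (with the slotwise product [wc]) are algebras of this
    kind, so the ring axioms are proved once. *)
Definition scmul (x y : {ffun B -> K^o}) : {ffun B -> K^o} :=
  [ffun k => \sum_i \sum_j x i * y j * c i j k].

Lemma scmulA :
  (forall i j k l, \sum_t c i j t * c t k l = \sum_t c j k t * c i t l) ->
  associative scmul.
Proof.
move=> cA x y z; apply/ffunP => l; rewrite !ffunE.
transitivity (\sum_i \sum_j \sum_k x i * y j * z k * \sum_t c j k t * c i t l).
  apply: eq_bigr => i _.
  under eq_bigr => t _ do rewrite ffunE mulr_sumr mulr_suml.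
  rewrite exchange_big; apply: eq_bigr => j _ /=.
  under eq_bigr => t _ do rewrite mulr_sumr mulr_suml.
  rewrite exchange_big; apply: eq_bigr => k _ /=.
  by rewrite mulr_sumr; apply: eq_bigr => t _; rewrite !mulrA.
symmetry; rewrite exchange_big /=.
transitivity (\sum_k \sum_i \sum_j x i * y j * z k * \sum_t c i j t * c t k l).
  apply: eq_bigr => k _.
  under eq_bigr => t _ do rewrite ffunE mulr_suml mulr_suml.
  rewrite exchange_big; apply: eq_bigr => i _ /=.
  under eq_bigr => t _ do rewrite mulr_suml mulr_suml.
  rewrite exchange_big; apply: eq_bigr => j _ /=.
  rewrite mulr_sumr; apply: eq_bigr => t _.
  by rewrite -!mulrA; congr (_ * (_ * _)); rewrite mulrCA.
rewrite exchange_big; apply: eq_bigr => i _ /=.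
rewrite exchange_big; apply: eq_bigr => j _ /=.
by apply: eq_bigr => k _; rewrite cA.
Qed.

Lemma scmulDl : left_distributive scmul +%R.
Proof.
move=> x y z; apply/ffunP => k; rewrite !ffunE -big_split; apply: eq_bigr => i _.
by rewrite -big_split; apply: eq_bigr => j _; rewrite !ffunE /= !mulrDl.
Qed.

Lemma scmulDr : right_distributive scmul +%R.
Proof.
move=> x y z; apply/ffunP => k; rewrite !ffunE -big_split; apply: eq_bigr => i _.
by rewrite -big_split; apply: eq_bigr => j _; rewrite !ffunE /= mulrDr mulrDl.
Qed.

Lemma scmulZl (a : K) (x y : {ffun B -> K^o}) : a *: scmul x y = scmul (a *: x) y.
Proof.
apply/ffunP => k; rewrite !ffunE scaler_sumr; apply: eq_bigr => i _.
rewrite scaler_sumr; apply: eq_bigr => j _; rewrite !ffunE.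
by rewrite /GRing.scale /= !mulrA.
Qed.

Lemma scmulZr (a : K) (x y : {ffun B -> K^o}) : a *: scmul x y = scmul x (a *: y).
Proof.
apply/ffunP => k; rewrite !ffunE scaler_sumr; apply: eq_bigr => i _.
rewrite scaler_sumr; apply: eq_bigr => j _; rewrite !ffunE.
by rewrite /GRing.scale /= !mulrA (mulrC a).
Qed.

Lemma scmul1x (u : {ffun B -> K^o}) :
  (forall j k, \sum_i u i * c i j k = (j == k)%:R) -> left_id u scmul.
Proof.
move=> hu x; apply/ffunP => k; rewrite ffunE exchange_big /=.
rewrite (bigD1 k) //= [X in _ + X]big1 => [|j jk].
  under eq_bigr => i _ do rewrite (mulrC (u i)) -mulrA.
  by rewrite -mulr_sumr hu eqxx mulr1 addr0.
under eq_bigr => i _ do rewrite (mulrC (u i)) -mulrA.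
by rewrite -mulr_sumr hu (negPf jk) mulr0.
Qed.

Lemma scmulx1 (u : {ffun B -> K^o}) :
  (forall i k, \sum_j u j * c i j k = (i == k)%:R) -> right_id u scmul.
Proof.
move=> hu x; apply/ffunP => k; rewrite ffunE.
rewrite (bigD1 k) //= [X in _ + X]big1 => [|i ik].
  under eq_bigr => j _ do rewrite -mulrA.
  by rewrite -mulr_sumr hu eqxx mulr1 addr0.
under eq_bigr => j _ do rewrite -mulrA.
by rewrite -mulr_sumr hu (negPf ik) mulr0.
Qed.

End StructureConstants.

Section QuaternionConstants.
Variable K : fieldType.

Lemma qmul_basisA (i j k : nat) : (i < 4)%N -> (j < 4)%N -> (k < 4)%N ->
  let m := qmul_basis in
  ((m (m i j).2 k).2 = (m i (m j k).2).2) /\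
  ((m i j).1 (+) (m (m i j).2 k).1 = (m j k).1 (+) (m i (m j k).2).1).
Proof.
case: i => [|[|[|[|i]]]] //; case: j => [|[|[|[|j]]]] //;
by case: k => [|[|[|[|k]]]].
Qed.

Lemma qmul_basis_lt (i j : nat) : (i < 4)%N -> (j < 4)%N -> ((qmul_basis i j).2 < 4)%N.
Proof. by case: i => [|[|[|[|i]]]] //; case: j => [|[|[|[|j]]]]. Qed.

Lemma qcE (i j k : 'I_4) :
  qc K i j k = (-1) ^+ (qmul_basis i j).1 * ((qmul_basis i j).2 == k)%:R.
Proof.
rewrite /qc; case: (qmul_basis i j) => [[] r] /=; case: (r == k);
by rewrite ?expr1 ?expr0 ?mulr1 ?mulr0.
Qed.

Lemma qcA (i j k l : 'I_4) :
  \sum_t qc K i j t * qc K t k l = \sum_t qc K j k t * qc K i t l.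
Proof.
have [h1 h2] := qmul_basisA (ltn_ord i) (ltn_ord j) (ltn_ord k).
have r1 := qmul_basis_lt (ltn_ord i) (ltn_ord j).
have r2 := qmul_basis_lt (ltn_ord j) (ltn_ord k).
rewrite (bigD1 (Ordinal r1)) //= big1 ?addr0; last first.
  move=> t; rewrite -val_eqE /= => /negPf ne.
  by rewrite qcE eq_sym ne mulr0 mul0r.
rewrite (bigD1 (Ordinal r2)) //= [X in _ = _ + X]big1 ?addr0; last first.
  move=> t; rewrite -val_eqE /= => /negPf ne.
  by rewrite qcE eq_sym ne mulr0 mul0r.
by rewrite !qcE /= !eqxx !mulr1 !mulrA h1 -!signr_addb h2.
Qed.

Lemma qc_unit_l (j k : 'I_4) : \sum_i (qe 0 : quat K) i * qc K i j k = (j == k)%:R.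
Proof.
rewrite (bigD1 0) //= big1 ?addr0 => [|i /negPf i0].
  by rewrite qcE !ffunE eqxx /= !mul1r -val_eqE.
by rewrite ffunE i0 mul0r.
Qed.

Lemma qc_unit_r (i k : 'I_4) : \sum_j (qe 0 : quat K) j * qc K i j k = (i == k)%:R.
Proof.
rewrite (bigD1 0) //= big1 ?addr0 => [|j /negPf j0].
  rewrite qcE !ffunE eqxx mul1r -[RHS]mul1r -val_eqE.
  by case: i => [[|[|[|[|i]]]] ?].
by rewrite ffunE j0 mul0r.
Qed.

End QuaternionConstants.

(** Fresh names that carry the algebra structures. They convert to [quat] and [tens], so [*] and
    [tmul] can be exchanged by conversion throughout. *)
Definition qalg (K : fieldType) : Type := quat K.
Definition talg (K : fieldType) (n : nat) : Type := tens K n.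

Section Algebras.
Variable K : fieldType.

HB.instance Definition _ := GRing.Lmodule.copy (qalg K) (quat K).

Definition qmul (x y : qalg K) : qalg K := scmul (@qc K) x y.

Lemma qmulA : associative qmul. Proof. exact: scmulA (@qcA K). Qed.
Lemma qmul1 : left_id (qe 0 : qalg K) qmul. Proof. exact: scmul1x (@qc_unit_l K). Qed.
Lemma qmulr1 : right_id (qe 0 : qalg K) qmul. Proof. exact: scmulx1 (@qc_unit_r K). Qed.
Lemma qone_neq0 : (qe 0 : qalg K) != 0.
Proof.
apply/eqP => /(congr1 (fun f : quat K => f 0)); rewrite !ffunE eqxx => /eqP.
by rewrite oner_eq0.
Qed.

HB.instance Definition _ := GRing.Zmodule_isNzRing.Build (qalg K)
  qmulA qmul1 qmulr1 (scmulDl (@qc K)) (scmulDr (@qc K)) qone_neq0.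
HB.instance Definition _ := GRing.Lmodule_isLalgebra.Build K (qalg K)
  (scmulZl (@qc K)).
HB.instance Definition _ := GRing.Lalgebra_isAlgebra.Build K (qalg K)
  (scmulZr (@qc K)).

Variable n : nat.

Definition wc (u v w : word n) : K := \prod_(m < n) qc K (u m) (v m) (w m).

(** A sum over words of a product over slots is a product over slots of sums over letters, which
    reduces associativity to that of H. *)
Lemma wcA (u v w x : word n) :
  \sum_t wc u v t * wc t w x = \sum_t wc v w t * wc u t x.
Proof.
transitivity (\prod_(m < n) \sum_t qc K (u m) (v m) t * qc K t (w m) (x m)).
  by rewrite bigA_distr_bigA; apply: eq_bigr => t _; rewrite -big_split.
under eq_bigr => m _ do rewrite qcA.
by rewrite bigA_distr_bigA; apply: eq_bigr => t _; rewrite -big_split.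
Qed.

Lemma prod_eq_word (v w : word n) : \prod_(m < n) (v m == w m)%:R = (v == w)%:R :> K.
Proof.
have [->|nvw] := eqVneq v w; first by rewrite big1 // => m _; rewrite eqxx.
have /existsP[m hm] : [exists m, v m != w m].
  apply/existsP; case: (pickP (fun m => v m != w m)) => [m hm|h]; first by exists m.
  by case/eqP: nvw; apply/ffunP => m; apply/eqP; move: (h m) => /negbFE.
by rewrite (bigD1 m) //= (negPf hm) mul0r.
Qed.

Lemma wc_unit_l (v w : word n) : \sum_u (tone n : tens K n) u * wc u v w = (v == w)%:R.
Proof.
rewrite -prod_eq_word.
transitivity (\prod_(m < n) \sum_i (qe 0 : quat K) i * qc K i (v m) (w m)).
  by rewrite bigA_distr_bigA; apply: eq_bigr => t _; rewrite ffunE -big_split.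
by apply: eq_bigr => m _; rewrite qc_unit_l.
Qed.

Lemma wc_unit_r (v w : word n) : \sum_u (tone n : tens K n) u * wc v u w = (v == w)%:R.
Proof.
rewrite -prod_eq_word.
transitivity (\prod_(m < n) \sum_i (qe 0 : quat K) i * qc K (v m) i (w m)).
  by rewrite bigA_distr_bigA; apply: eq_bigr => t _; rewrite ffunE -big_split.
by apply: eq_bigr => m _; rewrite qc_unit_r.
Qed.

HB.instance Definition _ := GRing.Lmodule.copy (talg K n) (tens K n).

Definition talg_mul (x y : talg K n) : talg K n := tmul x y.

Lemma tmulA : associative talg_mul. Proof. exact: scmulA wcA. Qed.
Lemma tmul1 : left_id (tone n : talg K n) talg_mul. Proof. exact: scmul1x wc_unit_l. Qed.
Lemma tmulr1 : right_id (tone n : talg K n) talg_mul. Proof. exact: scmulx1 wc_unit_r. Qed.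
Lemma tone_neq0 : (tone n : talg K n) != 0.
Proof.
apply/eqP => /(congr1 (fun f : tens K n => f [ffun=> 0])); rewrite !ffunE => /eqP.
by rewrite big1 ?oner_eq0 // => m _; rewrite !ffunE eqxx.
Qed.

HB.instance Definition _ := GRing.Zmodule_isNzRing.Build (talg K n)
  tmulA tmul1 tmulr1 (scmulDl wc) (scmulDr wc) tone_neq0.
HB.instance Definition _ := GRing.Lmodule_isLalgebra.Build K (talg K n)
  (scmulZl wc).
HB.instance Definition _ := GRing.Lalgebra_isAlgebra.Build K (talg K n)
  (scmulZr wc).

Definition PT (f : 'I_n -> qalg K) : talg K n := [ffun w : word n => \prod_(m < n) (f m : quat K) (w m)].

End Algebras.

Section QuaternionTable.
Variable K : fieldType.

Lemma qeM (i j : 'I_4) : (qe i : qalg K) * qe j =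
  (-1) ^+ (qmul_basis i j).1 *: (qe (inord (qmul_basis i j).2) : qalg K).
Proof.
apply/ffunP => k; rewrite !ffunE.
rewrite (bigD1 i) //= [X in _ + X]big1 ?addr0 => [|i' /negPf ni]; last first.
  by rewrite big1 // => j' _; rewrite !ffunE ni !mul0r.
rewrite (bigD1 j) //= [X in _ + X]big1 ?addr0 => [|j' /negPf nj]; last first.
  by rewrite !ffunE nj mulr0 mul0r.
rewrite !ffunE !eqxx !mul1r qcE /GRing.scale /=; congr (_ * _%:R).
by rewrite -val_eqE /= inordK ?qmul_basis_lt // eq_sym.
Qed.

Definition q1 : qalg K := qe 1.
Definition q2 : qalg K := qe 2.
Definition q3 : qalg K := qe 3.

Let qeMs i j b r : (qmul_basis (i : 'I_4) (j : 'I_4)).1 = b ->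
  (qmul_basis i j).2 = r -> (r < 4)%N -> forall k : 'I_4, val k = r ->
  (qe i : qalg K) * qe j = (-1) ^+ b *: (qe k : qalg K).
Proof.
by move=> hb hr r4 k hk; rewrite qeM hb hr; congr (_ *: qe _); apply: val_inj; rewrite /= inordK.
Qed.

Lemma q11 : q1 * q1 = -1. Proof. by rewrite (@qeMs 1 1 true 0 _ _ _ 0) // scaleN1r. Qed.
Lemma q22 : q2 * q2 = -1. Proof. by rewrite (@qeMs 2 2 true 0 _ _ _ 0) // scaleN1r. Qed.
Lemma q33 : q3 * q3 = -1. Proof. by rewrite (@qeMs 3 3 true 0 _ _ _ 0) // scaleN1r. Qed.
Lemma q12 : q1 * q2 = q3. Proof. by rewrite (@qeMs 1 2 false 3 _ _ _ 3) // scale1r. Qed.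
Lemma q21 : q2 * q1 = - q3. Proof. by rewrite (@qeMs 2 1 true 3 _ _ _ 3) // scaleN1r. Qed.
Lemma q23 : q2 * q3 = q1. Proof. by rewrite (@qeMs 2 3 false 1 _ _ _ 1) // scale1r. Qed.
Lemma q32 : q3 * q2 = - q1. Proof. by rewrite (@qeMs 3 2 true 1 _ _ _ 1) // scaleN1r. Qed.
Lemma q31 : q3 * q1 = q2. Proof. by rewrite (@qeMs 3 1 false 2 _ _ _ 2) // scale1r. Qed.
Lemma q13 : q1 * q3 = - q2. Proof. by rewrite (@qeMs 1 3 true 2 _ _ _ 2) // scaleN1r. Qed.

Lemma qalg_span (x : qalg K) : x = \sum_(i < 4) (x : quat K) i *: (qe i : qalg K).
Proof.
apply/ffunP => k; rewrite sum_ffunE (bigD1 k) //= big1 ?addr0 => [|i ik].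
  by rewrite !ffunE eqxx /GRing.scale /= mulr1.
by rewrite !ffunE eq_sym (negPf ik) /GRing.scale /= mulr0.
Qed.

End QuaternionTable.
Arguments q1 {K}. Arguments q2 {K}. Arguments q3 {K}.

(** * Pure tensors and sums over the slots *)

Section PureTensors.
Variables (K : fieldType) (n : nat).
Implicit Types (f g : 'I_n -> qalg K) (x y : qalg K).

Lemma eq_PT f g : f =1 g -> PT f = PT g.
Proof. by move=> fg; apply/ffunP => w; rewrite !ffunE; apply: eq_bigr => m _; rewrite fg. Qed.

Lemma ptensE (f : nat -> quat K) : ptens n f = PT (fun m => f m : qalg K).
Proof. by []. Qed.

Lemma PTM f g : PT f * PT g = PT (fun m => f m * g m).
Proof.
apply/ffunP => w; rewrite !ffunE.
transitivity (\prod_(m < n) \sum_i \sum_j (f m : quat K) i * (g m : quat K) j * qc K i j (w m));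
  last by apply: eq_bigr => m _; rewrite ffunE.
rewrite bigA_distr_bigA; apply: eq_bigr => u _; rewrite bigA_distr_bigA.
by apply: eq_bigr => v _; rewrite !ffunE !big_split.
Qed.

Lemma PT1 : PT (fun _ : 'I_n => 1 : qalg K) = 1.
Proof. by []. Qed.

Lemma PT_span (x : talg K n) :
  x = \sum_(w : word n) (x : tens K n) w *: PT (fun m => qe (w m) : qalg K).
Proof.
apply/ffunP => v; rewrite sum_ffunE (bigD1 v) //= big1 ?addr0 => [|w wv].
  rewrite !ffunE big1 /GRing.scale /= ?mulr1 // => m _; by rewrite ffunE eqxx.
rewrite !ffunE; under eq_bigr => m _ do rewrite ffunE.
by rewrite prod_eq_word eq_sym (negPf wv) /GRing.scale /= mulr0.
Qed.

Definition upd f m x : 'I_n -> qalg K := fun j => if j == m then x else f j.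

Lemma PT_updE f m x (w : word n) : (PT (upd f m x) : tens K n) w =
  (x : quat K) (w m) * \prod_(j < n | j != m) (f j : quat K) (w j).
Proof.
rewrite ffunE (bigD1 m) //= /upd eqxx; congr (_ * _).
by apply: eq_bigr => j /negPf ->.
Qed.

Lemma PT_updP f m a x y : PT (upd f m (a *: x + y)) = a *: PT (upd f m x) + PT (upd f m y).
Proof.
apply/ffunP => w; rewrite [LHS]PT_updE [RHS]ffunE [X in _ = X + _]ffunE.
by rewrite !PT_updE !ffunE /GRing.scale /= mulrDl mulrA.
Qed.

Definition PT_at f m x : talg K n := PT (upd f m x).
HB.instance Definition _ f m :=
  GRing.isLinear.Build K (qalg K) (talg K n) _ (PT_at f m) (PT_updP f m).

Definition sl m x : talg K n := PT (upd (fun _ => 1) m x).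

Lemma sl_is_linear m : linear (sl m). Proof. by move=> a x y; apply: PT_updP. Qed.
HB.instance Definition _ m := GRing.isLinear.Build K (qalg K) (talg K n) _ (sl m) (sl_is_linear m).

Lemma sl1 m : sl m 1 = 1.
Proof. by rewrite -PT1; apply: eq_PT => j; rewrite /upd; case: eqP. Qed.

Lemma slPT m x f : sl m x * PT f = PT (upd f m (x * f m)).
Proof.
rewrite PTM; apply: eq_PT => j; rewrite /upd; case: eqP => [->//|_]; by rewrite mul1r.
Qed.

Lemma slM m x y : sl m x * sl m y = sl m (x * y).
Proof. by rewrite slPT; apply: eq_PT => j; rewrite /upd eqxx; case: eqP. Qed.

Lemma sl_comm m m' x y : m != m' -> sl m x * sl m' y = sl m' y * sl m x.
Proof.
move=> mm'; rewrite !slPT; apply: eq_PT => j.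
rewrite /upd (negPf mm') [m' == m]eq_sym (negPf mm') !mulr1.
by case: (j =P m) => [->|//]; rewrite (negPf mm').
Qed.

(** The D x of the overview. *)
Definition dg x : talg K n := \sum_m sl m x.

Lemma dg_is_linear : linear dg.
Proof.
move=> a x y; rewrite /dg scaler_sumr -big_split.
by apply: eq_bigr => m _; rewrite linearP.
Qed.
HB.instance Definition _ := GRing.isLinear.Build K (qalg K) (talg K n) _ dg dg_is_linear.

Lemma dg1 : dg 1 = n%:R.
Proof. by rewrite /dg; under eq_bigr => m _ do rewrite sl1; rewrite sumr_const card_ord. Qed.

Lemma dg_sl m x y : dg x * sl m y - sl m y * dg x = sl m (x * y - y * x).
Proof.
rewrite /dg mulr_suml mulr_sumr -sumrB (bigD1 m) //= big1 ?addr0 => [|j jm].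
  by rewrite !slM linearB.
by rewrite (sl_comm _ _ jm) subrr.
Qed.

(** Distinct slots commute, so only the terms with both factors in one slot survive. Every sl2
    relation below is an instance. *)
Lemma dg_comm x y : dg x * dg y - dg y * dg x = dg (x * y - y * x).
Proof.
rewrite [dg y]/dg mulr_sumr mulr_suml -sumrB.
by apply: eq_bigr => m _; rewrite dg_sl.
Qed.

End PureTensors.

(** * The action of the symmetric group and averaging *)

Section Permutation.
Variables (K : numFieldType) (n : nat).
Implicit Types (x y : talg K n) (s t : {perm 'I_n}).

Definition tp s x : talg K n := Defs.tperm s x.

Lemma tp_is_linear s : linear (tp s).
Proof. by move=> a x y; apply/ffunP => w; rewrite !ffunE. Qed.
HB.instance Definition _ s := GRing.isLinear.Build K (talg K n) (talg K n) _ (tp s) (tp_is_linear s).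

Lemma tpPT s f : tp s (PT f) = PT (fun m => f (s^-1%g m)).
Proof.
apply/ffunP => w; rewrite !ffunE (reindex_inj (@perm_inj _ s^-1%g)).
by apply: eq_bigr => m _; rewrite ffunE permKV.
Qed.

Lemma tpM s x y : tp s (x * y) = tp s x * tp s y.
Proof.
rewrite (PT_span x) (PT_span y) mulr_suml !linear_sum mulr_suml.
apply: eq_bigr => u _; rewrite mulr_sumr !linear_sum mulr_sumr.
apply: eq_bigr => v _; rewrite !linearZ -!scalerAl -!scalerAr !linearZ /=.
by rewrite PTM !tpPT PTM !scalerA mulrC.
Qed.

Lemma tp1 s : tp s 1 = 1.
Proof. by rewrite -PT1 tpPT. Qed.

Lemma tpt s t x : tp s (tp t x) = tp (t * s)%g x.
Proof. by apply/ffunP => w; rewrite !ffunE; congr (_ _); apply/ffunP => m; rewrite !ffunE permM. Qed.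

Lemma tp_sl s m (q : qalg K) : tp s (sl m q) = sl (s m) q.
Proof. by rewrite tpPT; apply: eq_PT => j; rewrite /upd (canF_eq (permKV s)). Qed.

Lemma tp_dg s (q : qalg K) : tp s (dg n q) = dg n q.
Proof.
rewrite linear_sum [RHS](reindex_inj (@perm_inj _ s)).
by apply: eq_bigr => m _; apply: tp_sl.
Qed.

Definition symm x := forall s, tp s x = x.

Lemma symm1 : symm 1. Proof. by move=> s; apply: tp1. Qed.
Lemma symmM x y : symm x -> symm y -> symm (x * y).
Proof. by move=> hx hy s; rewrite tpM hx hy. Qed.
Lemma symmD x y : symm x -> symm y -> symm (x + y).
Proof. by move=> hx hy s; rewrite linearD /= hx hy. Qed.
Lemma symmZ a x : symm x -> symm (a *: x).
Proof. by move=> hx s; rewrite linearZ /= hx. Qed.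
Lemma symm_sum (I : Type) (r : seq I) (P : pred I) (F : I -> talg K n) :
  (forall i, P i -> symm (F i)) -> symm (\sum_(i <- r | P i) F i).
Proof. by move=> h s; rewrite linear_sum; apply: eq_bigr => i Pi; apply: h. Qed.

Definition sy x : talg K n := sym x.

Lemma syE x : sy x = (n`!%:R)^-1 *: \sum_s tp s x.
Proof. by []. Qed.

Lemma sy_is_linear : linear sy.
Proof.
move=> a x y; rewrite !syE scalerA mulrC -scalerA -scalerDr; congr (_ *: _).
by rewrite scaler_sumr -big_split; apply: eq_bigr => s _; rewrite linearP.
Qed.
HB.instance Definition _ := GRing.isLinear.Build K (talg K n) (talg K n) _ sy sy_is_linear.

Lemma sy_symm x : symm (sy x).
Proof.
move=> t; rewrite !syE linearZ linear_sum; congr (_ *: _).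
rewrite [RHS](reindex_inj (mulIg t)); apply: eq_bigr => s _; exact: tpt.
Qed.

Lemma sy_tp t x : sy (tp t x) = sy x.
Proof.
rewrite !syE; congr (_ *: _); rewrite [RHS](reindex_inj (mulgI t)).
by apply: eq_bigr => s _; rewrite tpt.
Qed.

Lemma sy_id x : symm x -> sy x = x.
Proof.
move=> hx; rewrite syE; under eq_bigr => s _ do rewrite hx.
rewrite sumr_const card_Sn -scaler_nat scalerA mulVf ?scale1r //.
by rewrite pnatr_eq0 -lt0n fact_gt0.
Qed.

Lemma syMl x y : symm x -> sy (x * y) = x * sy y.
Proof.
move=> hx; rewrite !syE -scalerAr; congr (_ *: _); rewrite mulr_sumr.
by apply: eq_bigr => s _; rewrite tpM hx.
Qed.

End Permutation.

(** * Generation of the symmetric tensors by the sums over slots *)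

Section Generation.
Variables (K : numFieldType) (n : nat) (W : talg K n -> Prop).
Hypothesis W1 : W 1.
Hypothesis WD : forall x y, W x -> W y -> W (x + y).
Hypothesis WZ : forall a x, W x -> W (a *: x).
Hypothesis WM : forall (q : qalg K) x, W x -> W (dg n q * x).

Let W0 : W 0. Proof. by rewrite -(scale0r 1); apply: WZ. Qed.

Let W_sum (I : Type) (r : seq I) (P : pred I) (F : I -> talg K n) :
  (forall i, P i -> W (F i)) -> W (\sum_(i <- r | P i) F i).
Proof. by move=> h; apply: big_ind. Qed.

Definition ew (w : word n) : talg K n := PT (fun m => qe (w m) : qalg K).
Definition wsupp (w : word n) := #|[set m | w m != 0]|.

(** Induction on the number of letters other than e_0. Removing one such letter q and multiplying by
    [dg n q] puts q back in every slot: in an e_0 slot this recovers w up to a permutation, in any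
    other slot it creates no new nontrivial letter. *)
Lemma sy_word_generated (w : word n) : W (sy (ew w)).
Proof.
move: {2}(wsupp w) (leqnn (wsupp w)) => j.
elim: j w => [|j IH] w hw.
  suff -> : ew w = 1 by rewrite sy_id //; apply: symm1.
  rewrite -PT1; apply: eq_PT => m; congr qe; apply/eqP.
  move: hw; rewrite leqn0 cards_eq0 => /eqP /setP /(_ m).
  by rewrite !inE => /negbFE.
have [hj|/ltnW hj] := leqP (wsupp w) j; first exact: IH.
have [m0 hm0|h0] := pickP [pred m | w m != 0]; last first.
  apply: IH; rewrite (_ : wsupp w = 0)%N //.
  by apply/eqP; rewrite cards_eq0; apply/eqP/setP => m; rewrite !inE; apply: h0.
pose w' : word n := [ffun m => if m == m0 then 0 else w m].
have sw' : (wsupp w' <= j)%N.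
  rewrite -ltnS; apply: leq_trans hw; rewrite [X in (_ < X)%N](cardsD1 m0) inE (hm0 : w m0 != 0) add1n ltnS.
  by apply/subset_leq_card/subsetP => m; rewrite !inE ffunE; case: (m == m0).
pose q : qalg K := qe (w m0).
(* The transposition of m and m0 carries q from slot m to its place in w, and averaging does not see
   it. *)
have termA m : w' m = 0 -> sy (sl m q * ew w') = sy (ew w).
  move=> w'm; rewrite -[RHS](sy_tp (perm.tperm m m0)) slPT tpPT w'm mulr1; congr sy.
  apply: eq_PT => i; rewrite /upd tpermV; case: tpermP => [->|->|/eqP/negPf -> /eqP/negPf i0].
  - by rewrite eqxx.
  - case: eqP => [<- //|]; rewrite !ffunE eqxx => /eqP/negPf hmm.
    by move: w'm; rewrite ffunE eq_sym hmm => ->.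
  - by rewrite ffunE i0.
(* Here q meets another letter; the product is a combination of basis letters, each giving a word
   supported inside w', so the induction hypothesis applies. *)
have termB m : w' m != 0 -> W (sy (sl m q * ew w')).
  move=> w'm; rewrite slPT (qalg_span (_ * _)).
  pose upw k : word n := [ffun i => if i == m then k else w' i].
  rewrite -[PT _]/(PT_at _ _ _) linear_sum linear_sum; apply: W_sum => k _.
  rewrite !linearZ /=; apply: WZ.
  have -> : PT_at (fun i => qe (w' i) : qalg K) m (qe k) = ew (upw k).
    by apply: eq_PT => i; rewrite /upd [upw k i]ffunE; case: eqP.
  apply: IH.
  apply: leq_trans sw'; apply/subset_leq_card/subsetP => i; rewrite !inE [upw k i]ffunE.
  by case: (i =P m) => [->|].
have WL : W (dg n q * sy (ew w')) by apply/WM/IH.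
rewrite -syMl in WL; last by move=> s; apply: tp_dg.
move: WL; rewrite /dg mulr_suml linear_sum /= (bigID (fun m => w' m == 0)) /=.
set N := #|[set m | w' m == 0]|.
have -> : \sum_(m | w' m == 0) sy (sl m q * ew w') = N%:R *: sy (ew w).
  rewrite (eq_bigr (fun=> sy (ew w))) => [|m /eqP]; last exact: termA.
  by rewrite sumr_const scaler_nat /N cardsE.
set rest := \sum_(m | _) _ => WL.
have Wr : W rest by apply: W_sum => m; apply: termB.
(* The slot m0 was emptied in w', so it is counted and the equation can be solved for
   [sy (ew w)]. *)
have N0 : N%:R != 0 :> K.
  rewrite pnatr_eq0 -lt0n; apply/card_gt0P; exists m0.
  by rewrite inE ffunE eqxx.
have -> : sy (ew w) = N%:R^-1 *: ((N%:R *: sy (ew w) + rest) + (-1) *: rest).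
  by rewrite scaleN1r addrK scalerA mulVf // scale1r.
by apply/WZ/WD => //; apply: WZ.
Qed.

(** An induction principle for Sym^n: a linear property that holds for 1 need only be stable under
    left multiplication by the [dg q]. *)
Lemma symm_generated x : symm x -> W x.
Proof.
move=> hx; rewrite -(sy_id hx) (PT_span x) linear_sum; apply: W_sum => w _.
by rewrite linearZ; apply/WZ/sy_word_generated.
Qed.

End Generation.

(** * The sl2-ladder *)

Section CasimirEigenvalues.
Variables (K : numFieldType) (n : nat).

Definition om (k : nat) : K := ((n - k) * k.+1)%:R.

(** [om] is quadratic in its index with axis of symmetry (n-1)/2, so the only other solution is the
    mirror image n-1-l. *)
Lemma om_inj j l : (j <= n)%N -> (l <= n)%N -> om j = om l -> j = l \/ (j + l).+1 = n.
Proof.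
move=> jn ln /eqP; rewrite eqr_nat => /eqP h.
have [jl|lj|] := ltngtP j l; last by left.
- right; have [d [d0 El]] : exists d, (0 < d)%N /\ l = (j + d)%N by exists (l - j)%N; lia.
  have [r En] : exists r, n = (l + r)%N by exists (n - l)%N; lia.
  subst l n; nia.
- right; have [d [d0 El]] : exists d, (0 < d)%N /\ j = (l + d)%N by exists (j - l)%N; lia.
  have [r En] : exists r, n = (j + r)%N by exists (n - j)%N; lia.
  subst j n; nia.
Qed.

Lemma om_neq m l : (uphalf n <= m <= n)%N -> (uphalf n <= l <= n)%N -> m != l ->
  om l - om m != 0.
Proof.
move=> /andP[m1 m2] /andP[l1 l2] ml; rewrite subr_eq0; apply/eqP => /om_inj [] //.
- by move=> lm; rewrite lm eqxx in ml.
- rewrite uphalf_half in m1 l1; lia.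
Qed.

Lemma om_rev k : (k < n)%N -> om (n - k.+1) = om k.
Proof. by move=> kn; rewrite /om; congr (_%:R); nia. Qed.

(** The Lagrange basis polynomial of the nodes [om m]; its value at Om is e_l (see [eidE]). *)
Definition lagr l : {poly K} :=
  \prod_(uphalf n <= m < n.+1 | m != l) ((om l - om m)^-1 *: ('X - (om m)%:P)).

(** One factor for each weight met when climbing from i to n. *)
Definition omprod i : {poly K} := \prod_(i <= m < n.+1) ('X - (om m)%:P).

Lemma lagrE l : lagr l = \prod_(uphalf n <= m < n.+1 | m != l) (om l - om m)^-1 *:
  \prod_(uphalf n <= m < n.+1 | m != l) ('X - (om m)%:P).
Proof. exact: scaler_prod. Qed.

Lemma lagr_om l : (uphalf n <= l <= n)%N -> (lagr l).[om l] = 1.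
Proof.
move=> hl; rewrite /lagr horner_prod big_seq_cond big1 // => m /andP[].
rewrite mem_index_iota ltnS => hm ml; rewrite hornerZ hornerXsubC mulVf //.
exact: om_neq.
Qed.

Lemma lagr_omprod l : (uphalf n <= l <= n)%N ->
  exists c, ('X - (om l)%:P) * lagr l = c *: omprod (uphalf n).
Proof.
move=> hl; rewrite lagrE -scalerAr; eexists; congr (_ *: _).
rewrite /omprod [RHS](bigD1_seq l) //= ?iota_uniq //.
by rewrite mem_index_iota ltnS.
Qed.

Lemma omprod_split i k : (i <= k <= n)%N -> exists p, omprod i = p * omprod k.
Proof.
move=> /andP[ik kn]; rewrite {1}/omprod (big_cat_nat (n := k)) //=; last by lia.
by eexists.
Qed.

(** The one factor missing from [lagr l] has index l < k, so every factor of [omprod k] is still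
    there. *)
Lemma lagr_split l k : (uphalf n <= l)%N -> (l < k <= n)%N -> exists p, lagr l = p * omprod k.
Proof.
move=> hl /andP[lk kn]; rewrite lagrE; move: (\prod_(_ <= _ < _ | _) (_ - _)^-1) => c.
rewrite (big_cat_nat (n := k)) //=; [|lia|lia].
rewrite scalerAl; eexists; congr (_ * _); rewrite [LHS]big_seq_cond [RHS]big_seq_cond.
apply: eq_bigl => m; rewrite mem_index_iota andbT; case: (ltnP m k) => [//|km].
by rewrite (_ : m != l) ?andbT //; lia.
Qed.

End CasimirEigenvalues.

Section Evaluation.
Variables (K : numFieldType) (A : algType K) (Om : A).
Notation ev := (horner_alg Om).

Lemma ev_comm (x : A) p : GRing.comm x Om -> GRing.comm x (ev p).
Proof.
move=> cx; elim/poly_ind: p => [|p c IH]; first by rewrite rmorph0; apply: commr0.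
rewrite rmorphD rmorphM /= horner_algX horner_algC.
apply: commrD; first exact: commrM.
by rewrite /GRing.comm -scalerAr -scalerAl mulr1 mul1r.
Qed.

Lemma ev_commV (x : A) p : GRing.comm x Om -> ev p * x = x * ev p.
Proof. by move=> /(ev_comm p). Qed.

Lemma evZ c p : ev (c *: p) = c *: ev p.
Proof. by rewrite linearZ /= mulr_algl. Qed.

Lemma evXsubC c : ev ('X - c%:P) = Om - c%:A.
Proof. by rewrite rmorphB /= horner_algX horner_algC. Qed.

Lemma ev_eigen (c : K) (x : A) p : Om * x = c *: x -> ev p * x = p.[c] *: x.
Proof.
move=> h; elim/poly_ind: p => [|p d IH]; first by rewrite rmorph0 mul0r horner0 scale0r.
rewrite rmorphD rmorphM /= horner_algX horner_algC mulrDl -mulrA h -scalerAr IH.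
by rewrite hornerMXaddC scalerDl scalerA mulrC -scalerAl mul1r.
Qed.

End Evaluation.

(* On weight k the factor Om - om k equals - F E and so climbs one step of the ladder,
   which ends at weight n. *)
Lemma ladder_kill (K : numFieldType) (A : algType K) (n : nat) (P : nat -> A) (E F Om : A) :
  (forall k, (k < n)%N -> E * P k = P k.+1 * E) -> E * P n = 0 ->
  (forall k, (k <= n)%N -> F * E * P k = om K n k *: P k - Om * P k) ->
  GRing.comm F Om ->
  forall k, (k <= n)%N -> horner_alg Om (omprod K n k) * P k = 0.
Proof.
move=> EP EPn FEP cF k kn.
have [j Ej] : exists j, (j + k)%N = n by exists (n - k)%N; lia.
elim: j k kn Ej => [|j IH] k kn Ej; rewrite /omprod big_ltn ?ltnS // mulrC rmorphM /= evXsubC.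
all: rewrite -mulrA mulrBl -scalerAl mul1r -opprB -FEP // mulrN -!mulrA.
  by rewrite (_ : k = n) ?EPn ?mulr0 ?oppr0 //.
rewrite EP; last by lia.
by rewrite [_ * (F * _)]mulrA (ev_commV _ cF) -mulrA [_ * (P _ * _)]mulrA IH ?mul0r ?mulr0 ?oppr0 //; lia.
Qed.

Section Ladder.
Variables (K : numFieldType) (A : algType K) (n : nat).
Variables (P : nat -> A) (E F Om : A).
Notation ev := (horner_alg Om).
Notation om := (om K n).
Hypothesis Psum : \sum_(k < n.+1) P k = 1.
Hypothesis PP : forall j k, (j <= n)%N -> (k <= n)%N -> P j * P k = if j == k then P k else 0.
Hypothesis EP : forall k, (k < n)%N -> E * P k = P k.+1 * E.
Hypothesis EPn : E * P n = 0.
Hypothesis FP : forall k, (k < n)%N -> F * P k.+1 = P k * F.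
Hypothesis FP0 : F * P 0%N = 0.
Hypothesis FEP : forall k, (k <= n)%N -> F * E * P k = om k *: P k - Om * P k.
Hypothesis EFP : forall k, (k <= n)%N -> E * F * P k = om (n - k) *: P k - Om * P k.
Hypothesis cE : GRing.comm E Om.
Hypothesis cF : GRing.comm F Om.

Lemma omprodP k : (k <= n)%N -> ev (omprod K n k) * P k = 0.
Proof. exact: ladder_kill EP EPn FEP cF k. Qed.

(** The same ladder descended: renumbering the weights by k -> n - k exchanges the roles of E and
    F. *)
Lemma omprodP' k : (k <= n)%N -> ev (omprod K n (n - k)) * P k = 0.
Proof.
move=> kn; rewrite -{2}(subKn kn).
apply: (@ladder_kill K A n (fun k => P (n - k)) F E Om) => //.
- move=> i hi; have -> : (n - i = (n - i.+1).+1)%N by lia.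
  by rewrite FP //; lia.
- by rewrite subnn.
- by move=> i hi; rewrite EFP ?leq_subr // subKn.
- exact: leq_subr.
Qed.

Definition el l : A := ev (lagr K n l).

(** For each weight either k or n - k is at least n/2, so one of the two ladders already kills it.
    Thus the upper half of the indices provides all eigenvalues of Om. *)
Lemma omprod_uphalf0 : ev (omprod K n (uphalf n)) = 0.
Proof.
rewrite -[LHS]mulr1 -Psum mulr_sumr big1 // => [[k kn]] _ /=.
have [h|h] := leqP (uphalf n) k.
  have [|p ->] := @omprod_split K n (uphalf n) k; first by lia.
  by rewrite rmorphM /= -mulrA omprodP ?mulr0 //.
have [|p ->] := @omprod_split K n (uphalf n) (n - k).
  by rewrite uphalf_half in h *; lia.
by rewrite rmorphM /= -mulrA omprodP' ?mulr0 //.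
Qed.

Section Component.
Variable l : nat.
Hypothesis hl : (uphalf n <= l <= n)%N.

Lemma Om_el : Om * el l = om l *: el l.
Proof.
have [c hc] := @lagr_omprod K n l hl.
apply/eqP; rewrite -subr_eq0 -[_ *: el l]mul1r -scalerAr scalerAl -mulrBl -evXsubC.
by rewrite /el -rmorphM /= hc evZ omprod_uphalf0 scaler0.
Qed.

Lemma ev_el p : ev p * el l = p.[om l] *: el l.
Proof. by apply: ev_eigen; apply: Om_el. Qed.

Lemma el_idem : el l * el l = el l.
Proof. by rewrite {1}/el ev_el lagr_om // scale1r. Qed.

Lemma el_comm x : GRing.comm x Om -> el l * x = x * el l.
Proof. exact: ev_commV. Qed.

Lemma el_weight0 k : (k <= n)%N -> (k < n - l)%N || (l < k)%N -> el l * P k = 0.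
Proof.
move=> kn /orP[h|h].
  have [||p hp] := @lagr_split K n l (n - k); [by case/andP: hl | by lia|].
  by rewrite /el hp rmorphM /= -mulrA omprodP' ?mulr0.
have [||p hp] := @lagr_split K n l k; [by case/andP: hl | by lia|].
by rewrite /el hp rmorphM /= -mulrA omprodP ?mulr0.
Qed.

(** Since F E v = 0, v is an eigenvector of Om for [om l], hence fixed by e_l, and e_l P_l is
    nonzero. Then descend: e_l E F P_(k+1) = (om_k - om_l) e_l P_(k+1) would vanish with e_l P_k,
    and the scalar is nonzero because k < l and because k >= n-l excludes the mirror image of l. *)
Lemma el_weight_neq0 v k : v != 0 -> E * v = 0 -> P l * v = v ->
  (n - l <= k <= l)%N -> el l * P k != 0.
Proof.
move=> v0 Ev Pv; have ln : (l <= n)%N by case/andP: hl.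
have Omv : Om * v = om l *: v.
  have := FEP ln; move/(congr1 (fun x => x * v)).
  rewrite mulrBl -scalerAl -!mulrA !Pv Ev mulr0 => /eqP.
  by rewrite eq_sym subr_eq0 => /eqP <-.
have base : el l * P l != 0.
  apply: contraNneq v0 => h.
  by rewrite -[v]scale1r -(lagr_om K hl) -(ev_eigen _ Omv) -/(el l) -Pv mulrA h mul0r.
move=> /andP[k1 k2].
have [j Ej] : exists j, (j + k)%N = l by exists (l - k)%N; lia.
elim: j k k1 k2 Ej => [|j IH] k k1 k2 Ej; first by rewrite (_ : k = l).
have h1 : el l * P k.+1 != 0 by apply: IH; lia.
have kn : (k < n)%N by lia.
apply: contraNneq h1 => h0.
have : el l * (E * F * P k.+1) = 0.
  rewrite -mulrA FP // mulrA (el_comm cE) -mulrA [el l * _]mulrA h0 mul0r mulr0 //.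
rewrite EFP // om_rev // mulrBr -scalerAr mulrA.
have -> : el l * Om = om l *: el l by rewrite -Om_el el_comm.
rewrite -scalerAl -scalerBl => /eqP; rewrite scaler_eq0 => /orP[|/eqP //].
rewrite subr_eq0 => /eqP/om_inj []; lia.
Qed.

End Component.

(** The shortest monomial in E and F that leads from weight k to weight j. *)
Definition ladder j k : A := if (k <= j)%N then E ^+ (j - k) else F ^+ (k - j).

Definition banded x := forall j k, (j <= n)%N -> (k <= n)%N ->
  exists q, P j * x * P k = ev q * ladder j k * P k.

Lemma banded1 : banded 1.
Proof.
move=> j k jn kn; rewrite mulr1 PP //; have [->|_] := eqVneq j k.
  by exists 1; rewrite rmorph1 mul1r /ladder leqnn subnn expr0 mul1r.
by exists 0; rewrite rmorph0 !mul0r.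
Qed.

Lemma bandedD x y : banded x -> banded y -> banded (x + y).
Proof.
move=> hx hy j k jn kn; have [q hq] := hx j k jn kn; have [r hr] := hy j k jn kn.
by exists (q + r); rewrite mulrDr mulrDl hq hr rmorphD /= !mulrDl.
Qed.

Lemma bandedZ a x : banded x -> banded (a *: x).
Proof.
move=> hx j k jn kn; have [q hq] := hx j k jn kn.
by exists (a *: q); rewrite -scalerAr -scalerAl hq evZ -!scalerAl.
Qed.

Lemma P0E : P 0%N * E = 0.
Proof.
rewrite -[LHS]mulr1 -Psum mulr_sumr big1 // => [[k kn]] _ /=; rewrite -mulrA.
have [h|h] := ltnP k n; last by rewrite (_ : k = n) ?EPn ?mulr0 //; lia.
by rewrite EP // mulrA PP //= mul0r.
Qed.

Lemma PnF : P n * F = 0.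
Proof.
rewrite -[LHS]mulr1 -Psum mulr_sumr big1 // => [[k kn]] _ /=; rewrite -mulrA.
case: k kn => [|k] kn; first by rewrite FP0 mulr0.
rewrite FP // mulrA PP //; last by lia.
by rewrite (_ : n == k = false) ?mul0r //; lia.
Qed.

Lemma FnP i k : (i <= k)%N -> (k <= n)%N -> F ^+ i * P k = P (k - i) * F ^+ i.
Proof.
move=> ik kn; elim: i ik => [|i IH] ik; first by rewrite mul1r mulr1 subn0.
rewrite exprS -mulrA IH 1?ltnW // mulrA (_ : k - i = (k - i.+1).+1)%N; last by lia.
by rewrite FP ?mulrA //; lia.
Qed.

Lemma EnP i k : (i + k <= n)%N -> E ^+ i * P k = P (i + k) * E ^+ i.
Proof.
move=> ik; elim: i ik => [|i IH] ik; first by rewrite mul1r mulr1.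
rewrite exprS -mulrA IH 1?ltnW // mulrA EP ?mulrA //; lia.
Qed.

Let shift (G X Y : A) q : GRing.comm G Om -> G * (ev q * X * Y) = ev q * (G * X * Y).
Proof. by move=> cG; rewrite !mulrA -(ev_commV _ cG). Qed.

(** P_(j+1) E x P_k = E P_j x P_k. If k <= j the monomial becomes longer; otherwise E cancels one F
    of the monomial at the price of a linear factor in Om. *)
Lemma bandedE x : banded x -> banded (E * x).
Proof.
move=> hx [|j] k jn kn; first by exists 0; rewrite rmorph0 mulrA P0E !mul0r.
have [q hq] := hx j k (ltnW jn) kn; rewrite mulrA -EP // -!mulrA [P j * _]mulrA hq /ladder shift //.
have [kj|jk] := leqP k j.
  by exists q; rewrite leqW // subSn // exprS !mulrA.
(* The leftmost of the factors F starts from weight j+1, where E F equals om_(n-j-1) - Om. *)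
exists (q * ((om (n - j.+1))%:P - 'X)).
have [i Ei] : exists i, (k - j = i.+1)%N by exists (k - j.+1)%N; lia.
have Ei' : (k - i = j.+1)%N by lia.
rewrite Ei exprS.
(* At k = j+1 the condition selects a power of E, but both monomials are empty there. *)
have -> : (if (k <= j.+1)%N then E ^+ (j.+1 - k) else F ^+ (k - j.+1)) = F ^+ i.
  have [h|h] := leqP k j.+1; last by congr (F ^+ _); lia.
  have -> : (j.+1 - k = 0)%N by lia.
  by have -> : i = 0%N by lia.
rewrite rmorphM rmorphB /= horner_algX horner_algC -!mulrA.
congr (_ * _); rewrite FnP //; last by lia.
by rewrite Ei' !mulrA EFP // [in RHS]mulrBl -scalerAl mul1r.
Qed.

Lemma bandedF x : banded x -> banded (F * x).
Proof.
move=> hx j k jn kn; case: (ltngtP j n) jn => // [jn _|-> _]; last first.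
  by exists 0; rewrite rmorph0 mulrA PnF !mul0r.
have [q hq] := hx j.+1 k jn kn; rewrite mulrA -FP // -!mulrA [P j.+1 * _]mulrA hq /ladder shift //.
have [kj|jk] := leqP k j; last first.
  exists q.
  have -> : (if (k <= j.+1)%N then E ^+ (j.+1 - k) else F ^+ (k - j.+1)) = F ^+ (k - j.+1).
    have [h|h] := leqP k j.+1 => //.
    have -> : (j.+1 - k = 0)%N by lia.
    by have -> : (k - j.+1 = 0)%N by lia.
  by rewrite -exprS -subSn // subSS mulrA.
exists (q * ((om j)%:P - 'X)); rewrite leqW // subSn // exprS.
rewrite rmorphM rmorphB /= horner_algX horner_algC -!mulrA.
congr (_ * _); rewrite EnP ?subnK //; last by exact: ltnW.
by rewrite !mulrA FEP // 1?ltnW // [in RHS]mulrBl -scalerAl mul1r.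
Qed.

Lemma banded_weight (D x : A) : (forall j, (j <= n)%N -> exists c : K, P j * D = c *: P j) ->
  banded x -> banded (D * x).
Proof.
move=> hD hx j k jn kn; have [c hc] := hD j jn; have [q hq] := hx j k jn kn.
exists (c *: q); rewrite mulrA hc -!scalerAl hq evZ -!scalerAl //.
Qed.

(** On the diagonal the monomial is empty, and e_l replaces Om by the number [om l] in the remaining
    polynomial. *)
Lemma banded_corner l x k : (uphalf n <= l <= n)%N -> banded x -> (k <= n)%N ->
  exists c : K, el l * (P k * x * P k) = c *: (el l * P k).
Proof.
move=> hl hx kn; have [q hq] := hx k k kn kn; exists q.[om l].
rewrite hq /ladder leqnn subnn mulr1 mulrA scalerAl -ev_el //; congr (_ * _).
by rewrite el_comm //; apply: commr_sym; apply: ev_comm.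
Qed.

End Ladder.

(** * The Casimir element *)

Section TensorProduct.
Variable K : fieldType.

Lemma wat_ord n (w : word n) (i : 'I_n) : wat w i = w i.
Proof. by rewrite /wat valK. Qed.

Lemma ttens_ptens n m p (f g : nat -> quat K) : (m + p)%N = n ->
  ttens (ptens m f) (ptens p g) =
  ptens n (fun i => if (i < m)%N then f i else g (i - m)%N).
Proof.
move=> <-; apply/ffunP => w; rewrite !ffunE eqxx big_split_ord; congr (_ * _).
  apply: eq_bigr => i _; rewrite /= !ltn_ord ffunE add0n.
  by rewrite -[nat_of_ord i]/(nat_of_ord (lshift p i)) wat_ord.
apply: eq_bigr => i _; rewrite /= ltnNge leq_addr /= addKn ffunE.
by rewrite -[(m + i)%N]/(nat_of_ord (rshift m i)) wat_ord.
Qed.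

Lemma ttensDl n m p (x x' : tens K m) (y : tens K p) :
  ttens (x + x') y = ttens x y + ttens x' y :> tens K n.
Proof. by apply/ffunP => w; rewrite !ffunE; case: eqP; rewrite ?addr0 // mulrDl. Qed.

Lemma ttensDr n m p (x : tens K m) (y y' : tens K p) :
  ttens x (y + y') = ttens x y + ttens x y' :> tens K n.
Proof. by apply/ffunP => w; rewrite !ffunE; case: eqP; rewrite ?addr0 // mulrDr. Qed.

Lemma ttensZl n m p a (x : tens K m) (y : tens K p) :
  ttens (a *: x) y = a *: ttens x y :> tens K n.
Proof.
by apply/ffunP => w; rewrite !ffunE; case: eqP; rewrite ?scaler0 // /GRing.scale /= mulrA.
Qed.

Lemma ttensZr n m p a (x : tens K m) (y : tens K p) :
  ttens x (a *: y) = a *: ttens x y :> tens K n.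
Proof.
by apply/ffunP => w; rewrite !ffunE; case: eqP; rewrite ?scaler0 // /GRing.scale /= mulrCA.
Qed.

Lemma ttens0l n m p (y : tens K p) : ttens (0 : tens K m) y = 0 :> tens K n.
Proof. by rewrite -(scale0r 0) ttensZl scale0r. Qed.

Lemma ttens0r n m p (x : tens K m) : ttens x (0 : tens K p) = 0 :> tens K n.
Proof. by rewrite -(scale0r 0) ttensZr scale0r. Qed.

Lemma ttens_suml n m p I (r : seq I) (F : I -> tens K m) (y : tens K p) :
  ttens (\sum_(i <- r) F i) y = \sum_(i <- r) ttens (F i) y :> tens K n.
Proof.
elim: r => [|i r IH]; first by rewrite !big_nil ttens0l.
by rewrite !big_cons ttensDl IH.
Qed.

Lemma ttens_sumr n m p I (r : seq I) (x : tens K m) (F : I -> tens K p) :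
  ttens x (\sum_(i <- r) F i) = \sum_(i <- r) ttens x (F i) :> tens K n.
Proof.
elim: r => [|i r IH]; first by rewrite !big_nil ttens0r.
by rewrite !big_cons ttensDr IH.
Qed.

End TensorProduct.

Section Casimir.
Variables (K : numFieldType) (n : nat).

(* The normalization makes om K n m the eigenvalue attached to beta n m, and lets the
   case n = 1 be treated with the others. *)
Definition Om : talg K n := (n * n.-1)%:R *: (tdeltan K n : talg K n).

(** Send x to x' by a transposition, then the image of y to y'; the second transposition leaves x'
    in place. *)
Lemma perm2 (T : finType) (x y x' y' : T) : x != y -> x' != y' ->
  exists s : {perm T}, s x = x' /\ s y = y'.
Proof.
move=> xy x'y'; exists (perm.tperm x x' * perm.tperm (perm.tperm x x' y) y')%g.
rewrite !permM tpermL; split; last by rewrite tpermL.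
rewrite tpermD //; last by rewrite eq_sym.
by rewrite -[X in _ != X](tpermL x x') (inj_eq perm_inj) eq_sym.
Qed.

Definition first_pair (q : qalg K) : talg K n := PT (fun m => if (m < 2)%N then q else 1).

(** The square has n diagonal terms, which form [dg (q * q)], and n(n-1) terms with q in two
    distinct slots. All the latter have the same average, by two-transitivity, and averaging does
    not alter the symmetric left-hand side. *)
Lemma dg_sqr (q : qalg K) :
  dg n q * dg n q = dg n (q * q) + (n * n.-1)%:R *: sy (first_pair q).
Proof.
have symL : symm (dg n q * dg n q - dg n (q * q)).
  by move=> s; rewrite linearB /= tpM !tp_dg.
apply/eqP; rewrite addrC -subr_eq; apply/eqP; rewrite -[LHS]sy_id //.
have -> : dg n q * dg n q - dg n (q * q) = \sum_m \sum_(m' | m' != m) sl m q * sl m' q.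
  rewrite {1 3}/dg mulr_suml -sumrB; apply: eq_bigr => m _.
  by rewrite /dg mulr_sumr (bigD1 m) //= slM addrC addrK.
rewrite linear_sum (eq_bigr (fun=> n.-1%:R *: sy (first_pair q))) => [|m _]; last first.
  rewrite linear_sum (eq_bigr (fun=> sy (first_pair q))) => [|m' m'm].
    rewrite sumr_const scaler_nat; congr (_ *+ _).
    by rewrite cardC1 card_ord.
  have n2 : (1 < n)%N.
    by move: m' m m'm; case: (n) => [[]//|[|//]] m' m; rewrite !ord1 eqxx.
  have n1 : (0 < n)%N := ltnW n2.
  have mm' : m != m' by rewrite eq_sym.
  have [s [s0 s1]] := @perm2 _ (Ordinal n1) (Ordinal n2) m m' isT mm'.
  rewrite -s0 -s1 -!tp_sl -tpM /= sy_tp; congr sy; rewrite slPT; apply: eq_PT => j.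
  rewrite /upd -!val_eqE /= mulr1.
  by case: (val j) => [|[|i]].
by rewrite sumr_const card_ord -scaler_nat scalerA natrM.
Qed.

(** Sum [dg_sqr] over the four e_i. The term e_0 contributes n^2 - n, and each e_i^2 = -1
    contributes n more, whence n^2 + 2n. *)
Lemma Om_casimir : (0 < n)%N -> Om = 4^-1 *: ((n * n + 2 * n)%:R +
  dg n q1 * dg n q1 + dg n q2 * dg n q2 + dg n q3 * dg n q3).
Proof.
move=> n0; transitivity (4^-1 *: \sum_(i < 4) (dg n (qe i) * dg n (qe i) - dg n ((qe i : qalg K) * qe i))); last first.
  rewrite !big_ord_recl big_ord0 addr0.
  have e0 : (qe ord0 : qalg K) = 1 by [].
  have e1 : (qe (lift ord0 ord0) : qalg K) = q1 by congr qe; apply: val_inj.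
  have e2 : (qe (lift ord0 (lift ord0 ord0)) : qalg K) = q2 by congr qe; apply: val_inj.
  have e3 : (qe (lift ord0 (lift ord0 (lift ord0 ord0))) : qalg K) = q3 by congr qe; apply: val_inj.
  rewrite e0 e1 e2 e3 q11 q22 q33 mulr1 !linearN /= dg1 !opprK; congr (_ *: _).
  have -> : (n * n + 2 * n)%:R = n%:R * n%:R - n%:R + n%:R + n%:R + n%:R :> talg K n.
    by rewrite subrK natrD natrM mul2n -addnn natrD addrA.
  set d := _ - _; by rewrite [LHS](AC (1*(2*(2*2))) (1*3*5*7*2*4*6)).
have [n1|n2] := leqP n 1.
  have E1 : (n * n.-1)%N = 0%N by nia.
  rewrite /Om E1 scale0r big1 ?scaler0 // => i _.
  by rewrite dg_sqr E1 scale0r addr0 subrr.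
under eq_bigr => i _ do rewrite dg_sqr addrAC subrr add0r.
rewrite -scaler_sumr scalerA mulrC -scalerA /Om; congr (_ *: _).
rewrite -linear_sum -linearZ /=; congr (sy _).
rewrite /tdelta ttensZl; congr (_ *: _); rewrite ttens_suml; apply: eq_bigr => i _.
rewrite /tone ttens_ptens ?subnKC //.
Qed.

(** The factor n(n-1) relating beta to om and Delta to Om cancels in each quotient. For n = 1 it is
    zero, but then l = 1 and [lagr] is an empty product. *)
Lemma eidE l : (0 < n)%N -> (uphalf n <= l <= n)%N ->
  eid n l = horner_alg Om (lagr K n l) :> talg K n.
Proof.
move=> n0 hl; rewrite rmorph_prod /= /eid; case: ifPn => [n1|n2].
  rewrite big1_seq // => m /andP[ml]; rewrite mem_index_iota => hm.
  exfalso; rewrite uphalf_half in hl hm; lia.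
have N0 : (n * n.-1)%:R != 0 :> K by rewrite pnatr_eq0 muln_eq0; lia.
have bE m : beta K n m = om K n m / (n * n.-1)%:R.
  have F0 : (4 * n * (n - 1))%:R != 0 :> K by rewrite pnatr_eq0 !muln_eq0; lia.
  apply/eqP; rewrite eqr_div // /om -!natrM eqr_nat; apply/eqP; nia.
change (\prod_(uphalf n <= m' < n.+1 | m' != l) ((beta K n l - beta K n m')^-1 *:
  ((tdeltan K n : talg K n) - (beta K n m')%:A)) = 
  \prod_(uphalf n <= m < n.+1 | m != l) horner_alg Om ((om K n l - om K n m)^-1 *: ('X - (om K n m)%:P))).
apply: eq_bigr => m ml.
rewrite evZ evXsubC !bE -mulrBl invfM invrK -scalerA; congr (_ *: _).
by rewrite scalerBr; congr (_ - _); rewrite scalerA mulrCA divff ?mulr1.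
Qed.
End Casimir.

(** * Weights over the complex numbers *)

Section MatrixUnits.
Variable C : numClosedFieldType.

Definition qA : qalg C := 2^-1 *: (1 + 'i *: q1).
Definition qB : qalg C := 2^-1 *: (1 - 'i *: q1).
(** [qA], [qE], [qF], [qB] are the matrix units of indices 11, 12, 21, 22, to which the names of the
    lemmas below refer. The sign in [qF] compensates q2^2 = -1. *)
Definition qE : qalg C := qA * q2.
Definition qF : qalg C := - (qB * q2).

Let u : qalg C := 'i *: q1.
Let uu : u * u = 1.
Proof. by rewrite -scalerAl -scalerAr scalerA -expr2 sqrCi q11 scaleN1r opprK. Qed.
Let q2u : q2 * u = - (u * q2).
Proof. by rewrite -scalerAl -scalerAr q12 q21 scalerN. Qed.
Let half2 (x : qalg C) : 2^-1 *: (x + x) = x.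
Proof. by rewrite -mulr2n -scaler_nat scalerA mulVf ?scale1r // pnatr_eq0. Qed.

Lemma qAA : qA * qA = qA.
Proof.
rewrite /qA -scalerAl -scalerAr -/u; congr (_ *: _).
by rewrite mulrDl mul1r mulrDr mulr1 uu addrC [u + 1]addrC half2.
Qed.
Lemma qBB : qB * qB = qB.
Proof.
rewrite /qB -scalerAl -scalerAr -/u; congr (_ *: _).
by rewrite mulrBl mul1r mulrBr mulr1 uu opprB half2.
Qed.
Lemma qAB : qA * qB = 0.
Proof.
rewrite /qA /qB -scalerAl -scalerAr -/u.
by rewrite mulrDl mul1r mulrBr mulr1 uu addrA subrK subrr !scaler0.
Qed.
Lemma qBA : qB * qA = 0.
Proof.
rewrite /qA /qB -scalerAl -scalerAr -/u.
by rewrite mulrBl mul1r mulrDr mulr1 uu [u + 1]addrC subrr !scaler0.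
Qed.
Lemma qA_add_qB : qA + qB = 1.
Proof. by rewrite /qA /qB -scalerDr addrACA addrN addr0 half2. Qed.
Lemma q2A : q2 * qA = qB * q2.
Proof. by rewrite /qA /qB -scalerAl -scalerAr -/u mulrDr mulrBl mulr1 mul1r q2u. Qed.
Lemma q2B : q2 * qB = qA * q2.
Proof. by rewrite /qA /qB -scalerAl -scalerAr -/u mulrBr mulrDl mulr1 mul1r q2u opprK. Qed.

Lemma qA12 : qA * qE = qE. Proof. by rewrite /qE mulrA qAA. Qed.
Lemma q12A : qE * qA = 0. Proof. by rewrite /qE -mulrA q2A mulrA qAB mul0r. Qed.
Lemma qA21 : qA * qF = 0. Proof. by rewrite /qF mulrN mulrA qAB mul0r oppr0. Qed.
Lemma q21A : qF * qA = qF. Proof. by rewrite /qF mulNr -mulrA q2A mulrA qBB. Qed.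
Lemma q1221 : qE * qF = qA.
Proof. by rewrite /qE /qF mulrN -mulrA [q2 * _]mulrA q2B -!mulrA q22 !mulrN mulr1 qAA opprK. Qed.
Lemma q2112 : qF * qE = qB.
Proof. by rewrite /qE /qF mulNr -mulrA [q2 * _]mulrA q2A -!mulrA q22 !mulrN mulr1 qBB opprK. Qed.

Lemma q2E : q2 = qE - qF.
Proof. by rewrite /qE /qF opprK -mulrDl qA_add_qB mul1r. Qed.
Lemma q1E : q1 = - 'i *: (2%:R *: qA - 1).
Proof.
rewrite scalerA mulfV ?pnatr_eq0 // scale1r [1 + _]addrC addrK scalerA mulNr -expr2 sqrCi opprK.
by rewrite scale1r.
Qed.
Lemma q3E : q3 = - 'i *: (qE + qF).
Proof.
rewrite -q12 {1}q1E -scalerAl; congr (_ *: _); rewrite /qE /qF -mulrBl; congr (_ * _).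
by rewrite -qA_add_qB scaler_nat mulr2n addrKA.
Qed.

Lemma qalg_matrix_units (q : qalg C) : exists c0 c1 c2 c3,
  q = c0 *: 1 + c1 *: qA + c2 *: qE + c3 *: qF.
Proof.
have e0 : (qe ord0 : qalg C) = 1 by [].
have e1 : (qe (lift ord0 ord0) : qalg C) = q1 by congr qe; apply: val_inj.
have e2 : (qe (lift ord0 (lift ord0 ord0)) : qalg C) = q2 by congr qe; apply: val_inj.
have e3 : (qe (lift ord0 (lift ord0 (lift ord0 ord0))) : qalg C) = q3 by congr qe; apply: val_inj.
have := qalg_span q; rewrite !big_ord_recl big_ord0 addr0 e0 e1 e2 e3 q1E q2E q3E.
move: (_ ord0) (_ (lift _ _)) (_ (lift _ _)) (_ (lift _ _)) qA qE qF => x t z y a b c hq.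
exists (x - y * - 'i), (y * - 'i * 2), (z + t * - 'i), (- z + t * - 'i).
rewrite [LHS]hq !scalerA !scalerBr !scalerDr !scalerA !scalerDl !scaleNr.
by rewrite [LHS](AC (1*(2*(2*2))) ((1*3)*2*(4*6)*(5*7))).
Qed.

End MatrixUnits.

Section Sl2.
Variables (C : numClosedFieldType) (n : nat).
Hypothesis n0 : (0 < n)%N.
Notation A := (talg C n).

Definition Eop : A := dg n (qE C).
Definition Fop : A := dg n (qF C).
Definition Dop : A := dg n (qA C).

Lemma comm_DE : Dop * Eop - Eop * Dop = Eop.
Proof. by rewrite dg_comm qA12 q12A subr0. Qed.
Lemma comm_DF : Dop * Fop - Fop * Dop = - Fop.
Proof. by rewrite dg_comm qA21 q21A sub0r linearN. Qed.
Lemma comm_EF : Eop * Fop - Fop * Eop = 2 *: Dop - n%:R.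
Proof.
have -> : 2 *: Dop - n%:R = dg n (2 *: qA C - 1) by rewrite linearB linearZ /= dg1.
rewrite dg_comm q1221 q2112; congr (dg _ _).
by rewrite -(qA_add_qB C) scaler_nat mulr2n addrKA.
Qed.

(** With H = 2D - n, the sums for q1, q2, q3 are -iH, E - F and -i(E + F); on squaring, E^2 and F^2
    cancel. *)
Lemma Om_sl2 : 4 *: Om C n = (n * n + 2 * n)%:R - (2 *: Dop - n%:R) * (2 *: Dop - n%:R)
  - 2 *: (Eop * Fop + Fop * Eop).
Proof.
rewrite Om_casimir // scalerA mulfV ?pnatr_eq0 // scale1r -!addrA; congr (_ + _).
have d1 : dg n q1 = - 'i *: (2 *: Dop - n%:R).
  by rewrite q1E linearZ linearB linearZ /= dg1.
have d2 : dg n q2 = Eop - Fop by rewrite q2E linearB.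
have d3 : dg n q3 = - 'i *: (Eop + Fop) by rewrite q3E linearZ linearD.
have sq (x : A) : (- 'i *: x) * (- 'i *: x) = - (x * x).
  by rewrite -scalerAl -scalerAr scalerA mulrNN -expr2 sqrCi scaleN1r.
rewrite d1 d2 d3 !sq; congr (_ + _).
rewrite mulrBl !mulrBr mulrDl !mulrDr scaler_nat mulr2n.
move: (Eop * Eop) (Fop * Fop) (Eop * Fop) (Fop * Eop) => a b c d.
rewrite !opprD !opprK.
by rewrite [LHS](AC ((2*2)*(2*2)) ((1*5)*(4*8)*((2*3)*(6*7)))) /= !subrr !add0r.
Qed.

(** Bracketing with a basis element is a derivation that rotates the other two imaginary units, so
    their contributions to the bracket with the sum of squares cancel. *)
Lemma Om_comm_dg (q : qalg C) : GRing.comm (dg n q) (Om C n).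
Proof.
pose Z := dg n q1 * dg n q1 + dg n q2 * dg n q2 + dg n q3 * dg n q3 : A.
have OmZ : Om C n = 4^-1 *: ((n * n + 2 * n)%:R + Z) by rewrite Om_casimir // /Z !addrA.
have lie (x y : qalg C) : dg n x * (dg n y * dg n y) - (dg n y * dg n y) * dg n x =
   dg n (x * y - y * x) * dg n y + dg n y * dg n (x * y - y * x).
  by rewrite -dg_comm mulrBl mulrBr !mulrA addrA subrK.
have dgN (x : qalg C) : dg n (- x) = - dg n x by rewrite linearN.
have dgD (x y : qalg C) : dg n (x + y) = dg n x + dg n y by rewrite linearD.
have cZ i : GRing.comm (dg n (qe i : qalg C)) Z.
  apply/eqP; rewrite -subr_eq0 /Z !mulrDl !mulrDr.
  rewrite [X in X == _](_ : _ = (dg n (qe i) * (dg n q1 * dg n q1) - (dg n q1 * dg n q1) * dg n (qe i))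
   + (dg n (qe i) * (dg n q2 * dg n q2) - (dg n q2 * dg n q2) * dg n (qe i))
   + (dg n (qe i) * (dg n q3 * dg n q3) - (dg n q3 * dg n q3) * dg n (qe i))); last first.
    by rewrite !opprD [RHS](AC (2*2*2) ((1*3*5)*(2*4*6))).
  rewrite !lie.
  have /orP[/orP[/orP[/eqP->|/eqP->]|/eqP->]|/eqP->] : (i == 0) || (i == 1) || (i == 2) || (i == 3).
    by case: i => [[|[|[|[|]]]] ?].
  - by rewrite (_ : qe 0 = 1 :> qalg C) // !mul1r !mulr1 !subrr linear0 !(mul0r, mulr0) !addr0.
  - rewrite -[qe 1]/q1 q12 q21 q13 q31 subrr linear0 !(mul0r, mulr0) !opprK !addr0 add0r.
    rewrite -opprD dgN !dgD mulNr mulrN !mulrDl !mulrDr.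
    by rewrite -opprD [X in _ - X]addrC subrr.
  - rewrite -[qe 2]/q2 q12 q21 q23 q32 subrr linear0 !(mul0r, mulr0) !opprK !addr0.
    rewrite -opprD dgN !dgD mulNr mulrN !mulrDl !mulrDr.
    by rewrite -opprD [X in _ + X]addrC addNr.
  - rewrite -[qe 3]/q3 q13 q31 q23 q32 subrr linear0 !(mul0r, mulr0) !opprK !addr0.
    rewrite -opprD dgN !dgD mulNr mulrN !mulrDl !mulrDr.
    by rewrite -opprD [X in _ - X]addrC subrr.
rewrite OmZ /GRing.comm -scalerAr -scalerAl; congr (_ *: _).
rewrite mulrDl mulrDr; congr (_ + _); first exact: commr_nat.
rewrite (qalg_span q) linear_sum mulr_suml mulr_sumr; apply: eq_bigr => i _.
by rewrite linearZ /= -scalerAl -scalerAr cZ.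
Qed.

Lemma Om_comm_symm (x : A) : symm x -> GRing.comm x (Om C n).
Proof.
apply: (@symm_generated C n (fun x => GRing.comm x (Om C n))).
- exact/commr_sym/commr1.
- by move=> y z hy hz; apply/commr_sym/commrD; apply/commr_sym.
- by move=> a y hy; rewrite /GRing.comm -[LHS]scalerAl -[RHS]scalerAr hy.
- by move=> q y hy; apply/commr_sym/commrM; apply/commr_sym => //; apply: Om_comm_dg.
Qed.

End Sl2.

Lemma PT_eq0 (K : fieldType) n (f : 'I_n -> qalg K) m : f m = 0 -> PT f = 0.
Proof.
by move=> fm; apply/ffunP => w; rewrite !ffunE (bigD1 m) //= fm ffunE mul0r.
Qed.

Lemma PT_sl (K : fieldType) n (f : 'I_n -> qalg K) m x :
  PT f * sl m x = PT (upd f m (f m * x)).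
Proof.
rewrite PTM; apply: eq_PT => j; rewrite /upd; case: eqP => [->//|_]; by rewrite mulr1.
Qed.

Lemma upd_id (K : fieldType) n (f : 'I_n -> qalg K) m x : x = f m -> PT (upd f m x) = PT f.
Proof. by move=> ->; apply: eq_PT => j; rewrite /upd; case: eqP => [->|]. Qed.

Lemma upd_0 (K : fieldType) n (f : 'I_n -> qalg K) m : PT (upd f m 0) = 0.
Proof. by apply: (@PT_eq0 _ _ _ m); rewrite /upd eqxx. Qed.

Section WeightShift.
Variables (K : numFieldType) (A : algType K) (n : nat) (P : nat -> A) (D : A).
Hypothesis Psum : \sum_(k < n.+1) P k = 1.
Hypothesis DP : forall k, D * P k = k%:R *: P k.
Hypothesis PD : forall k, P k * D = k%:R *: P k.

(** Between P_j and P_k the commutator acts as j - k by the weights and as c by hypothesis. *)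
Lemma weight_shift (G : A) (c : K) j k : D * G - G * D = c *: G ->
  j%:R != k%:R + c -> P j * G * P k = 0.
Proof.
move=> hG jk.
have : P j * (D * G - G * D) * P k = (j%:R - k%:R) *: (P j * G * P k).
  by rewrite mulrBr mulrBl mulrA PD -!mulrA DP -!scalerAl -!scalerAr -scalerBl.
rewrite hG -scalerAr -scalerAl => /eqP; rewrite -subr_eq0 -scalerBl scaler_eq0.
by rewrite subr_eq0 eq_sym subr_eq addrC (negPf jk) => /eqP.
Qed.

Lemma weight_raise (G : A) k : D * G - G * D = G -> (k < n)%N -> G * P k = P k.+1 * G.
Proof.
rewrite -[X in _ = X]scale1r => hG kn.
have z j k' : j != k'.+1 -> P j * G * P k' = 0.
  by move=> jk; apply: weight_shift hG _; rewrite natr1 eqr_nat.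
transitivity (P k.+1 * G * P k).
  rewrite -[LHS]mul1r -Psum mulr_suml (bigD1 (Ordinal (kn : k.+1 < n.+1)%N)) //= mulrA.
  by rewrite big1 ?addr0 // => j jk; rewrite mulrA z.
rewrite -[RHS]mulr1 -Psum mulr_sumr (bigD1 (Ordinal (ltnW kn : k < n.+1)%N)) //=.
rewrite big1 ?addr0 // => j jk; rewrite z //.
by move: jk; rewrite -val_eqE /= eqSS eq_sym.
Qed.

Lemma weight_raise_top (G : A) : D * G - G * D = G -> G * P n = 0.
Proof.
rewrite -[X in _ = X]scale1r => hG.
rewrite -[LHS]mul1r -Psum mulr_suml big1 // => j _; rewrite mulrA.
by apply: weight_shift hG _; rewrite natr1 eqr_nat; case: j => j /= hj; lia.
Qed.

Lemma weight_lower (G : A) k : D * G - G * D = - G -> (k < n)%N -> G * P k.+1 = P k * G.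
Proof.
rewrite -[X in _ = X]scaleN1r => hG kn.
have z j k' : j.+1 != k' -> P j * G * P k' = 0.
  by move=> jk; apply: weight_shift hG _; rewrite eq_sym subr_eq natr1 eqr_nat eq_sym.
transitivity (P k * G * P k.+1).
  rewrite -[LHS]mul1r -Psum mulr_suml (bigD1 (Ordinal (ltnW kn : k < n.+1)%N)) //= mulrA.
  by rewrite big1 ?addr0 // => j jk; rewrite mulrA z // eqSS.
rewrite -[RHS]mulr1 -Psum mulr_sumr (bigD1 (Ordinal (kn : k.+1 < n.+1)%N)) //=.
by rewrite big1 ?addr0 // => j jk; rewrite z // eq_sym.
Qed.

Lemma weight_lower_bot (G : A) : D * G - G * D = - G -> G * P 0%N = 0.
Proof.
rewrite -[X in _ = X]scaleN1r => hG.
rewrite -[LHS]mul1r -Psum mulr_suml big1 // => j _; rewrite mulrA.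
by apply: weight_shift hG _; rewrite eq_sym subr_eq natr1 eqr_nat.
Qed.

Lemma weight_vector (v : A) l : (l <= n)%N -> D * v = l%:R *: v -> P l * v = v.
Proof.
move=> ln Dv; rewrite -[RHS]mul1r -Psum mulr_suml.
rewrite (bigD1 (Ordinal (ln : l < n.+1)%N)) //= big1 ?addr0 // => j jl.
have : P j * (D * v) = P j * D * v by rewrite mulrA.
rewrite Dv PD -scalerAr -scalerAl => /eqP; rewrite -subr_eq0 -scalerBl scaler_eq0.
by rewrite subr_eq0 eqr_nat eq_sym -[_ == l]/(j == Ordinal (ln : l < n.+1)%N) (negPf jl) => /eqP.
Qed.

End WeightShift.

Section Weights.
Variables (C : numClosedFieldType) (n : nat).
Hypothesis n0 : (0 < n)%N.
Notation A := (talg C n).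

Definition PA (S : {set 'I_n}) : A := PT (fun m => if m \in S then qA C else qB C).
(** The P_k of the overview as a sum over subsets of slots, a form that makes orthogonality
    immediate; [sy_PA] relates it to the average. *)
Definition Pw (k : nat) : A := \sum_(S : {set 'I_n} | #|S| == k) PA S.

Lemma PA_mul S T : PA S * PA T = if S == T then PA S else 0.
Proof.
rewrite PTM; have [<-|nST] := eqVneq S T.
  by apply: eq_PT => m; case: ifP; rewrite ?qAA ?qBB.
have [m hm|h] := pickP (fun m => (m \in S) != (m \in T)); last first.
  by case/eqP: nST; apply/setP => m; apply/eqP; move: (h m) => /negbFE.
by apply: (@PT_eq0 _ _ _ m); move: hm; case: (m \in S); case: (m \in T) => // _; rewrite ?qAB ?qBA.
Qed.

Lemma PA_sum : \sum_(S : {set 'I_n}) PA S = 1.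
Proof.
rewrite -PT1 -(@eq_PT _ _ (fun=> qA C + qB C)) => [|m]; last by rewrite qA_add_qB.
apply/ffunP => w; rewrite sum_ffunE ffunE.
under [RHS]eq_bigr => m _ do rewrite ffunE.
rewrite (bigA_distr _ _ (fun m => (qA C : quat C) (w m)) (fun m => (qB C : quat C) (w m))).
by apply: eq_bigr => S _; rewrite ffunE; apply: eq_bigr => m _; case: ifP.
Qed.

Lemma Pw_sum : \sum_(k < n.+1) Pw k = 1.
Proof.
rewrite -PA_sum (partition_big (fun S : {set 'I_n} => inord #|S| : 'I_n.+1) xpredT) //=.
apply: eq_bigr => k _; apply: eq_bigl => S; rewrite -val_eqE /= inordK // ltnS.
by rewrite -[X in (_ <= X)%N](card_ord n) max_card.
Qed.

Lemma Pw_mul j k : Pw j * Pw k = if j == k then Pw k else 0.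
Proof.
rewrite /Pw mulr_suml; have [->|jk] := eqVneq j k.
  apply: eq_bigr => S /eqP hS; rewrite mulr_sumr (bigD1 S) ?hS //= PA_mul eqxx.
  by rewrite big1 ?addr0 // => T /andP[_ TS]; rewrite PA_mul eq_sym (negPf TS).
rewrite big1 // => S /eqP hS; rewrite mulr_sumr big1 // => T /eqP hT.
rewrite PA_mul; case: eqP => // ST; by rewrite -hS -hT ST eqxx in jk.
Qed.

Lemma Dop_Pw k : Dop C n * Pw k = k%:R *: Pw k.
Proof.
rewrite /Pw mulr_sumr scaler_sumr; apply: eq_bigr => S /eqP <-.
rewrite /Dop /dg mulr_suml (bigID (mem S)) /= [X in _ + X]big1 ?addr0 => [|m mS].
  rewrite (eq_bigr (fun=> PA S)) ?sumr_const ?scaler_nat // => m mS.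
  by rewrite slPT mS upd_id // mS qAA.
by rewrite slPT (negPf mS) qAB upd_0.
Qed.

Lemma Pw_Dop k : Pw k * Dop C n = k%:R *: Pw k.
Proof.
rewrite /Pw mulr_suml scaler_sumr; apply: eq_bigr => S /eqP <-.
rewrite /Dop /dg mulr_sumr (bigID (mem S)) /= [X in _ + X]big1 ?addr0 => [|m mS].
  rewrite (eq_bigr (fun=> PA S)) ?sumr_const ?scaler_nat // => m mS.
  by rewrite PT_sl mS upd_id // mS qAA.
by rewrite PT_sl (negPf mS) qBA upd_0.
Qed.

Lemma tp_PA s S : tp s (PA S) = PA (s @: S).
Proof.
rewrite tpPT; apply: eq_PT => m.
by rewrite -{2}(permKV s m) (mem_imset _ _ (@perm_inj _ s)).
Qed.

Lemma symm_Pw k : symm (Pw k).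
Proof.
move=> s; rewrite linear_sum [RHS](reindex_inj (imset_inj (@perm_inj _ s))) /=.
apply: eq_big => [S|S _]; first by rewrite card_imset //; apply: perm_inj.
exact: tp_PA.
Qed.

Lemma EPw k : (k < n)%N -> Eop C n * Pw k = Pw k.+1 * Eop C n.
Proof. exact: (weight_raise Pw_sum Dop_Pw Pw_Dop (comm_DE C n)). Qed.
Lemma EPwn : Eop C n * Pw n = 0.
Proof. exact: (weight_raise_top Pw_sum Dop_Pw Pw_Dop (comm_DE C n)). Qed.
Lemma FPw k : (k < n)%N -> Fop C n * Pw k.+1 = Pw k * Fop C n.
Proof. exact: (weight_lower Pw_sum Dop_Pw Pw_Dop (comm_DF C n)). Qed.
Lemma FPw0 : Fop C n * Pw 0 = 0.
Proof. exact: (weight_lower_bot Pw_sum Dop_Pw Pw_Dop (comm_DF C n)). Qed.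

Lemma Om_Pw k : 4 *: (Om C n * Pw k) =
  ((n * n + 2 * n)%:R - (2 * k%:R - n%:R) ^+ 2) *: Pw k
   - 2 *: (Eop C n * Fop C n * Pw k + Fop C n * Eop C n * Pw k).
Proof.
have hD : (2 *: Dop C n - n%:R) * Pw k = (2 * k%:R - n%:R) *: Pw k.
  by rewrite mulrBl -scalerAl Dop_Pw scalerA [n%:R * Pw k]mulr_natl -[_ *+ n]scaler_nat -scalerBl.
rewrite scalerAl Om_sl2 //; move: (2 *: Dop C n - n%:R) hD => X hD.
rewrite !mulrBl -[X * X * _]mulrA hD -scalerAr hD scalerA -expr2.
by rewrite [_%:R * Pw k]mulr_natl -[_ *+ (_ + _)]scaler_nat scalerBl -scalerAl [(_ + _) * Pw k]mulrDl.
Qed.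

Lemma EF_Pw k : Eop C n * Fop C n * Pw k = Fop C n * Eop C n * Pw k + (2 * k%:R - n%:R) *: Pw k.
Proof.
apply/eqP; rewrite addrC -subr_eq -mulrBl comm_EF mulrBl -scalerAl Dop_Pw scalerA.
by rewrite [n%:R * Pw k]mulr_natl -[_ *+ n]scaler_nat -scalerBl.
Qed.

(** On weight k, H is d = 2k - n and E F = F E + d, so 4 Om = n^2 + 2n - d^2 - 2d - 4 F E; the
    constant equals 4(n-k)(k+1). *)
Lemma FEPw k : (k <= n)%N -> Fop C n * Eop C n * Pw k = om C n k *: Pw k - Om C n * Pw k.
Proof.
move=> kn; have f4 : 4 != 0 :> C by rewrite pnatr_eq0.
apply: (scalerI f4); rewrite scalerBr Om_Pw EF_Pw.
set X := Fop C n * Eop C n * Pw k; set Y := Pw k; set d := _ - n%:R.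
have -> : (n * n + 2 * n)%:R - d ^+ 2 = 4 * om C n k + 2 * d.
  by rewrite /om /d natrD !natrM natrB // -natr1; ring.
have -> : 4 *: X = 2 *: X + 2 *: X by rewrite -scalerDl; congr (_ *: _); ring.
rewrite [(4 * _ + _) *: Y]scalerDl !scalerDr !scalerA [(2 *: X + _) + 2 *: X]addrAC.
by rewrite [_ *: Y + _ *: Y]addrC opprB addrA [_ *: Y + _]addrC opprD addrA addrAC addrK addrK.
Qed.

Lemma EFPw k : (k <= n)%N -> Eop C n * Fop C n * Pw k = om C n (n - k) *: Pw k - Om C n * Pw k.
Proof.
move=> kn; rewrite EF_Pw FEPw // addrAC -scalerDl; congr (_ *: _ - _).
by rewrite /om subKn // !natrM -!natr1 natrB //; ring.
Qed.

Lemma Om_comm_E : GRing.comm (Eop C n) (Om C n). Proof. exact: Om_comm_dg. Qed.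
Lemma Om_comm_F : GRing.comm (Fop C n) (Om C n). Proof. exact: Om_comm_dg. Qed.
Let hpos i (hi : (2 * i.+1 <= n)%N) : (2 * i < n)%N. Proof. by lia. Qed.
Let hpos' i (hi : (2 * i.+1 <= n)%N) : ((2 * i).+1 < n)%N. Proof. by lia. Qed.

(** The last clause says that the slots from 2i on still hold a, so a further factor F_p - F_q can
    act on the next pair. There the bracket of E with F_p is 2a - 1, which fixes v, so E F_p v = v =
    E F_q v and the difference is killed. It is nonzero, because E_p sends F_p v to v and F_q v to
    0. *)
Lemma highest_weight_vector i : (2 * i <= n)%N -> exists v : A,
  [/\ v != 0, Eop C n * v = 0, Dop C n * v = (n - i)%:R *: v &
      forall m : 'I_n, (2 * i <= m)%N -> sl m (qA C) * v = v].
Proof.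
elim: i => [_|i IH hi].
  exists (PT (fun=> qA C)).
  have hm m : sl m (qA C) * PT (fun=> qA C) = PT (fun=> qA C) by rewrite slPT upd_id // qAA.
  split => //.
  (* The coordinate at the word made of e_0 only is 2^-n. *)
  - apply/eqP => /(congr1 (fun f : tens C n => f [ffun=> 0])); rewrite !ffunE.
    under eq_bigr => m _ do rewrite !ffunE /=.
    move/eqP; rewrite prodf_seq_eq0 => /hasP[m _] /=.
    rewrite /GRing.scale /= mulr0 addr0 mulr1 invr_eq0 pnatr_eq0 //.
  - by rewrite /Eop /dg mulr_suml big1 // => m _; rewrite slPT q12A upd_0.
  - rewrite /Dop /dg mulr_suml (eq_bigr (fun=> PT (fun=> qA C))) => [|m _]; last exact: hm.
    by rewrite sumr_const card_ord scaler_nat subn0.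
have i2 : (2 * i <= n)%N by lia.
have [v [v0 Ev Dv hv]] := IH i2.
pose p := Ordinal (hpos hi); pose q := Ordinal (hpos' hi).
have pq : p != q by rewrite -val_eqE /= neq_ltn ltnSn.
pose G : A := sl p (qF C) - sl q (qF C).
have hcomm (m : 'I_n) : (2 * i <= m)%N -> sl m (qE C * qF C - qF C * qE C) * v = v.
  move=> hm; have -> : qE C * qF C - qF C * qE C = 2 *: qA C - 1.
    by rewrite q1221 q2112 -(qA_add_qB C) scaler_nat mulr2n addrKA.
  by rewrite linearB linearZ /= sl1 mulrBl -scalerAl mul1r hv // scaler_nat mulr2n addrK.
have slE (m : 'I_n) : (2 * i <= m)%N -> Eop C n * (sl m (qF C) * v) = v.
  move=> hm; have := dg_sl m (qE C) (qF C); rewrite -/(Eop C n) => /(congr1 (fun z => z * v)).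
  by rewrite mulrBl hcomm // -!mulrA Ev mulr0 subr0.
have slD (m : 'I_n) : (2 * i <= m)%N ->
   Dop C n * (sl m (qF C) * v) = (n - i.+1)%:R *: (sl m (qF C) * v).
  move=> hm; have := dg_sl m (qA C) (qF C); rewrite -/(Dop C n) => /(congr1 (fun z => z * v)).
  have slN (x : qalg C) : sl m (- x) = - sl m x by rewrite linearN.
  rewrite qA21 q21A sub0r (slN (qF C)) mulNr [(_ - _) * v]mulrBl.
  rewrite -[Dop C n * _ * v]mulrA -[_ * Dop C n * v]mulrA Dv => /eqP.
  rewrite subr_eq => /eqP ->; rewrite -scalerAr -scaleN1r -scalerDl; congr (_ *: _).
  by rewrite addrC -[(n - i)%N](_ : (n - i.+1).+1 = _)%N -?natr1 ?addrK //; lia.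
have hp : (2 * i <= p)%N by [].
have hq : (2 * i <= q)%N by rewrite /=.
exists (G * v); split.
- apply: contraNneq v0 => Gv; rewrite -(hv p hp) -q1221 -slM.
  have ep : sl p (qE C) * v = 0 by rewrite -(hv p hp) mulrA slM q12A linear0 mul0r.
  have : sl p (qE C) * (G * v) = 0 by rewrite Gv mulr0.
  rewrite /G mulrBl mulrBr [_ * (sl q _ * v)]mulrA (sl_comm _ _ pq) -[_ * _ * v]mulrA ep mulr0 subr0.
  by rewrite mulrA => ->.
- by rewrite /G mulrBl mulrBr !slE // subrr.
- by rewrite /G mulrBl mulrBr !slD // scalerBr.
- move=> m hm; rewrite /G mulrBl mulrBr !mulrA.
  have mp : m != p by rewrite -val_eqE /=; lia.
  have mq : m != q by rewrite -val_eqE /=; lia.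
  by rewrite (sl_comm _ _ mp) (sl_comm _ _ mq) -!mulrA hv //; lia.
Qed.

Section Component.
Variable l : nat.
Hypothesis hl : (uphalf n <= l <= n)%N.
Definition eC : A := eid n l.

Lemma eC_el : eC = el n (Om C n) l.
Proof. exact: eidE. Qed.

Let PPw j k : (j <= n)%N -> (k <= n)%N -> Pw j * Pw k = if j == k then Pw k else 0.
Proof. by move=> *; apply: Pw_mul. Qed.
Lemma eC_idem : eC * eC = eC.
Proof. by rewrite eC_el; exact: (el_idem Pw_sum EPw EPwn FPw FPw0 FEPw EFPw Om_comm_E Om_comm_F). Qed.

Lemma eC_comm x : symm x -> eC * x = x * eC.
Proof. by rewrite eC_el => sx; apply/el_comm/Om_comm_symm. Qed.

Lemma eC_weight0 k : (k <= n)%N -> (k < n - l)%N || (l < k)%N -> eC * Pw k = 0.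
Proof. by rewrite eC_el; exact: (el_weight0 EPw EPwn FPw FPw0 FEPw EFPw Om_comm_E Om_comm_F hl). Qed.

Lemma eC_weight_neq0 k : (n - l <= k <= l)%N -> eC * Pw k != 0.
Proof.
have [|v [v0 Ev Dv _]] := @highest_weight_vector (n - l).
  by have := hl; rewrite uphalf_half; lia.
have ln : (l <= n)%N by case/andP: hl.
rewrite subKn // in Dv; have Pv := weight_vector Pw_sum Pw_Dop ln Dv.
by rewrite eC_el; exact: (el_weight_neq0 Pw_sum EPw EPwn FPw FPw0 FEPw EFPw Om_comm_E Om_comm_F hl v0 Ev Pv).
Qed.

Lemma symm_banded (x : A) : symm x -> banded n Pw (Eop C n) (Fop C n) (Om C n) x.
Proof.
apply: symm_generated.
- exact: banded1.
- exact: bandedD.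
- exact: bandedZ.
move=> q {}x hx.
have bE : banded n Pw (Eop C n) (Fop C n) (Om C n) (Eop C n * x).
  exact: (bandedE Pw_sum PPw EPw EPwn FPw EFPw Om_comm_E).
have bF : banded n Pw (Eop C n) (Fop C n) (Om C n) (Fop C n * x).
  exact: (bandedF Pw_sum PPw EPw FPw FPw0 FEPw Om_comm_F).
have bD : banded n Pw (Eop C n) (Fop C n) (Om C n) (Dop C n * x).
  by apply: banded_weight => // j _; exists j%:R; apply: Pw_Dop.
have [c0 [c1 [c2 [c3 hq]]]] := qalg_matrix_units q.
have -> : dg n q * x = c0 *: (n%:R *: x) + c1 *: (Dop C n * x) + c2 *: (Eop C n * x) + c3 *: (Fop C n * x).
  have -> : dg n q = c0 *: n%:R + c1 *: Dop C n + c2 *: Eop C n + c3 *: Fop C n.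
    have dgD (y z : qalg C) : dg n (y + z) = dg n y + dg n z by rewrite linearD.
    have dgZ a (y : qalg C) : dg n (a *: y) = a *: dg n y by rewrite linearZ.
    by rewrite hq dgD dgD dgD (dgZ c0) (dgZ c1) (dgZ c2) (dgZ c3) dg1.
  move: (Dop C n) (Eop C n) (Fop C n) => d e f.
  by rewrite !mulrDl -!scalerAl mulr_natl scaler_nat.
apply: bandedD; [apply: bandedD; [apply: bandedD|]|]; apply: bandedZ => //.
exact: bandedZ.
Qed.

Lemma corner (x : A) k : symm x -> (k <= n)%N ->
  exists c : C, eC * (Pw k * x * Pw k) = c *: (eC * Pw k).
Proof.
move=> sx kn; rewrite eC_el.
apply: (banded_corner Pw_sum EPw EPwn FPw FPw0 FEPw EFPw Om_comm_E Om_comm_F) => //.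
exact: symm_banded.
Qed.

End Component.
End Weights.

(** * Coefficientwise change of field, used for the inclusion of R in C and for conjugation *)

Section FieldMap.
Variables (K K' : fieldType) (phi : {rmorphism K -> K'}).

Definition qmap (x : quat K) : quat K' := [ffun i => phi (x i)].
Definition tmap n (x : tens K n) : tens K' n := [ffun w => phi (x w)].

Lemma qmap_qe i : qmap (qe i) = qe i.
Proof. by apply/ffunP => j; rewrite !ffunE rmorph_nat. Qed.

Lemma tmapD n (x y : tens K n) : tmap (x + y) = tmap x + tmap y.
Proof. by apply/ffunP => w; rewrite !ffunE rmorphD. Qed.

Lemma tmapB n (x y : tens K n) : tmap (x - y) = tmap x - tmap y.
Proof. by apply/ffunP => w; rewrite !ffunE rmorphB. Qed.

Lemma tmap0 n : tmap (0 : tens K n) = 0.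
Proof. by apply/ffunP => w; rewrite !ffunE rmorph0. Qed.

Lemma tmapZ n a (x : tens K n) : tmap (a *: x) = phi a *: tmap x.
Proof. by apply/ffunP => w; rewrite !ffunE /GRing.scale /= rmorphM. Qed.

Lemma tmap_sum n I (r : seq I) (P : pred I) (F : I -> tens K n) :
  tmap (\sum_(i <- r | P i) F i) = \sum_(i <- r | P i) tmap (F i).
Proof. by apply: (big_morph (@tmap n) (@tmapD n) (tmap0 n)). Qed.

Lemma qc_map i j k : phi (qc K i j k) = qc K' i j k.
Proof. by rewrite !qcE rmorphM rmorph_sign rmorph_nat. Qed.

Lemma tmapM n (x y : tens K n) : tmap (tmul x y) = tmul (tmap x) (tmap y).
Proof.
apply/ffunP => w; rewrite !ffunE rmorph_sum; apply: eq_bigr => u _.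
rewrite rmorph_sum; apply: eq_bigr => v _; rewrite !ffunE !rmorphM rmorph_prod.
by congr (_ * _); apply: eq_bigr => m _; rewrite qc_map.
Qed.

Lemma tmap_ptens n f : tmap (ptens n f) = ptens n (fun m => qmap (f m)).
Proof.
by apply/ffunP => w; rewrite !ffunE rmorph_prod; apply: eq_bigr => m _; rewrite ffunE.
Qed.

Lemma eq_ptens n (f g : nat -> quat K') : f =1 g -> ptens n f = ptens n g.
Proof. by move=> fg; apply/ffunP => w; rewrite !ffunE; apply: eq_bigr => m _; rewrite fg. Qed.

Lemma tmap_qe n i : tmap (ptens n (fun _ => qe i)) = ptens n (fun _ => qe i).
Proof. by rewrite tmap_ptens; apply: eq_ptens => m; rewrite qmap_qe. Qed.

Lemma tmap_tone n : tmap (tone n) = tone n.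
Proof. exact: tmap_qe. Qed.

Lemma tmap_ttens n m p (x : tens K m) (y : tens K p) :
  tmap (ttens x y : tens K n) = ttens (tmap x) (tmap y).
Proof. by apply/ffunP => w; rewrite !ffunE; case: ifP; rewrite ?rmorph0 // rmorphM. Qed.

Lemma tmap_tpow m (x : tens K m) j L : tmap (tpow x j L) = tpow (tmap x) j L.
Proof.
elim: j L => [|j IH] L /=; last by rewrite tmap_ttens IH.
by apply/ffunP => w; rewrite !ffunE rmorph_nat.
Qed.

Lemma tmap_tperm n s (x : tens K n) : tmap (Defs.tperm s x) = Defs.tperm s (tmap x).
Proof. by apply/ffunP => w; rewrite !ffunE. Qed.

Lemma tmap_sym n (x : tens K n) : tmap (sym x) = sym (tmap x).
Proof.
rewrite /sym tmapZ fmorphV rmorph_nat tmap_sum; congr (_ *: _).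
by apply: eq_bigr => s _; rewrite tmap_tperm.
Qed.

Lemma tmap_tdeltan n : tmap (tdeltan K n) = tdeltan K' n.
Proof.
rewrite /tdeltan tmap_sym tmap_ttens tmap_tone /tdelta tmapZ fmorphV rmorph_nat tmap_sum.
by under eq_bigr => i _ do rewrite tmap_qe.
Qed.

Lemma tmap_tsq : tmap tsq = tsq.
Proof. by rewrite /tsq tmapZ tmapD !tmap_qe fmorphV rmorph_nat. Qed.

Lemma tmap_eid n l : tmap (eid n l) = eid n l.
Proof.
rewrite /eid; case: ifP => _; first exact: tmap_tone.
rewrite (big_morph (@tmap n) (@tmapM n) (tmap_tone n)); apply: eq_bigr => m _.
have betaE j : phi (beta K n j) = beta K' n j by rewrite /beta fmorph_div !rmorph_nat.
by rewrite tmapZ tmapB tmapZ fmorphV rmorphB !betaE tmap_tdeltan tmap_tone.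
Qed.

Lemma tmap_inj n : injective (@tmap n).
Proof.
by move=> x y /ffunP h; apply/ffunP => w; move: (h w); rewrite !ffunE; apply: fmorph_inj.
Qed.

Lemma tmap_inS n l (x : tens K n) : inS l x -> inS l (tmap x).
Proof.
move=> [s [ss ->]]; exists (tmap s); split; last by rewrite tmapM tmap_eid.
by move=> t; rewrite -tmap_tperm ss.
Qed.

Lemma tmap_idem n (x : tens K n) : idem x -> idem (tmap x).
Proof. by rewrite /idem -tmapM => ->. Qed.

End FieldMap.

Section Criteria.
Variables (K : fieldType) (n l : nat).

(** A summand y of an orthogonal splitting of x satisfies x y = y = y x, so only idempotents of the
    corner of x matter. *)
Lemma prim_idem_intro (x : talg K n) : inS l x -> x * x = x -> x <> 0 ->
  (forall y : talg K n, inS l y -> y * y = y -> x * y = y -> y * x = y -> y = 0 \/ y = x) ->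
  prim_idem l x.
Proof.
move=> Sx xx x0 h; split => // -[y [z [[Sy Sz] [iy iz] [y0 z0] [yz zy] xyz]]].
pose y' : talg K n := y; pose z' : talg K n := z.
have xE : x = y' + z' by [].
have yy : y' * y' = y' by [].
have yz' : y' * z' = 0 by [].
have zy' : z' * y' = 0 by [].
have [| |/y0 []|yx] := h y' Sy yy.
- by rewrite xE mulrDl yy zy' addr0.
- by rewrite xE mulrDr yy yz' addr0.
by apply: z0; move/eqP: xE; rewrite yx addrC -subr_eq subrr eq_sym => /eqP.
Qed.

(** Injectivity comes for free: if f i = f j with i and j distinct, then f i = f i f j = 0. *)
Lemma complete_poi_intro (J : eqType) (I : seq J) (f : J -> talg K n) :
  uniq I -> {in I, forall i, prim_idem l (f i)} ->
  {in I &, forall i j, i != j -> f i * f j = 0} ->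
  \sum_(i <- I) f i = eid n l -> complete_poi l I f.
Proof.
move=> uI prim orth sumI; split => // i j iI jI fij.
apply/eqP; apply/negPn/negP => ij; have [_ fi fi0 _] := prim i iI.
by apply: fi0; rewrite -fi {2}fij; apply: orth.
Qed.

End Criteria.

(** * Corner rings *)

Lemma scale_idem (K : fieldType) (A : algType K) (c : K) (x y : A) :
  x * x = x -> y = c *: x -> y * y = y -> y = 0 \/ y = x.
Proof.
move=> xx -> /eqP; rewrite -scalerAl -scalerAr xx -subr_eq0 scalerA -scalerBl scaler_eq0.
case/orP => [|/eqP ->]; last by left; rewrite scaler0.
rewrite -[X in _ - X]mulr1 -mulrBr mulf_eq0 subr_eq0 => /orP[] /eqP ->.
  by left; rewrite scale0r.
by right; rewrite scale1r.
Qed.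

Section QuaternionicCorner.
Variables (C : numClosedFieldType) (A : algType C) (cj : A -> A) (p p' e J y : A).
Hypotheses (pp : p * p = p) (pp' : p' * p' = p').
Hypotheses (ee : e * e = e) (ep : e * p = p * e) (ep' : e * p' = p' * e) (eJ : e * J = J * e).
Hypotheses (Jp : J * p = p' * J) (Jp' : J * p' = p * J) (JJ : J * J = -1) (ep0 : e * p != 0).
Hypotheses (cjM : forall x z, cj (x * z) = cj x * cj z)
  (cjZ : forall c x, cj (c *: x) = c^* *: cj x)
  (cjp : cj p = p') (cjp' : cj p' = p) (cje : cj e = e) (cjJ : cj J = J) (cjy : cj y = y).
Hypotheses (yy : y * y = y) (ey : e * y = y)
  (qy : (p + p') * y = y) (yq : y * (p + p') = y).

(** The four blocks of y are alpha, b and, because y is fixed by [cj], their conjugates. Idempotency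
    reads alpha^2 - |b|^2 = alpha and b (alpha + alpha^* - 1) = 0; these leave only b = 0 and alpha
    = 0 or 1. *)
Lemma quaternionic_corner (alpha beta0 : C) :
  e * (p * y * p) = alpha *: (e * p) -> e * (p * (J * y) * p) = beta0 *: (e * p) ->
  y = 0 \/ y = (p + p') * e.
Proof.
move=> ha hb0.
have h11 : p * y * p = alpha *: (e * p) by rewrite -ha !mulrA ep -(mulrA p e y) ey.
(* p J = J p' turns the second hypothesis into a formula for J p' y p; cancelling J costs the sign
   of J^2 = -1. *)
pose b := - beta0.
have h21 : p' * y * p = b *: (J * (e * p)).
  rewrite /b scaleNr scalerAr -hb0.
  have -> : e * (p * (J * y) * p) = J * (p' * y * p).
    by rewrite !mulrA ep -(mulrA p e J) eJ -!mulrA (mulrA e y p) ey !mulrA -Jp'.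
  by rewrite !mulrA JJ !mulN1r !mulNr opprK.
have h22 : p' * y * p' = alpha^* *: (e * p').
  by have := congr1 cj h11; rewrite cjZ !cjM cjp cje cjy.
have h12 : p * y * p' = b^* *: (J * (e * p')).
  by have := congr1 cj h21; rewrite cjZ !cjM cjp cjp' cje cjy cjJ.
have split_y x z : x * y * y * z = (x * y * p) * (p * y * z) + (x * y * p') * (p' * y * z).
  rewrite -[X in _ * X * z]qy mulrDl mulrDr mulrDl !mulrA.
  by rewrite -(mulrA (x * y) p p) pp -(mulrA (x * y) p' p') pp'.
have eJp : J * (e * p) != 0.
  apply: contraNneq ep0 => h; have : J * (J * (e * p)) = 0 by rewrite h mulr0.
  by rewrite mulrA JJ mulN1r => /eqP; rewrite oppr_eq0.
have E1 : alpha * alpha - b * b^* = alpha.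
  have : p * y * y * p = p * y * p by rewrite -(mulrA p y y) yy.
  rewrite split_y h11 h12 h21 -!scalerAl -!scalerAr !scalerA.
  have -> : e * p * (e * p) = e * p by rewrite mulrA -[e * p * e]mulrA -ep mulrA ee -mulrA pp.
  have -> : J * (e * p') * (J * (e * p)) = - (e * p).
    rewrite -!mulrA [p' * (J * _)]mulrA -Jp [e * (J * p * _)]mulrA [e * (J * p)]mulrA eJ !mulrA JJ.
    by rewrite !mulN1r !mulNr -(mulrA e p e) -ep mulrA ee -mulrA pp.
  rewrite scalerN -scaleNr -scalerDl => /eqP; rewrite -subr_eq0 -scalerBl scaler_eq0 (negPf ep0) orbF.
  by rewrite subr_eq0 [b^* * b]mulrC => /eqP.
have E2 : b = 0 \/ alpha + alpha^* = 1.
  have : p' * y * y * p = p' * y * p by rewrite -(mulrA p' y y) yy.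
  rewrite split_y h11 h21 h22 -!scalerAl -!scalerAr !scalerA.
  have -> : J * (e * p) * (e * p) = J * (e * p).
    by rewrite -mulrA; congr (_ * _); rewrite mulrA -[e * p * e]mulrA -ep mulrA ee -mulrA pp.
  have -> : e * p' * (J * (e * p)) = J * (e * p).
    rewrite !mulrA -(mulrA e p' J) -Jp !mulrA eJ -!mulrA; congr (_ * _).
    by rewrite [p * (e * p)]mulrA -ep !mulrA ee -mulrA pp.
  rewrite -scalerDl => /eqP; rewrite -subr_eq0 -scalerBl scaler_eq0 (negPf eJp) orbF.
  have -> : b * alpha + alpha^* * b - b = b * (alpha + alpha^* - 1) by ring.
  rewrite mulf_eq0 => /orP[/eqP ->|]; first by left.
  by rewrite subr_eq0 => /eqP ->; right.
(* Otherwise alpha^* = 1 - alpha, so |alpha|^2 = alpha - alpha^2 = -|b|^2 and both vanish by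
   positivity. *)
have b0 : b = 0.
  case: E2 => // aa.
  have s0 : alpha * alpha^* + b * b^* = 0.
    have -> : alpha^* = 1 - alpha by rewrite -aa addrC addKr.
    by move/eqP: E1; rewrite subr_eq => /eqP E1; rewrite mulrBr mulr1 E1 opprD addrA subrr add0r addNr.
  have := s0 => /eqP; rewrite paddr_eq0 ?mul_conjC_ge0 // !mul_conjC_eq0 => /andP[_ /eqP //].
have aa : alpha * alpha = alpha by have := E1; rewrite b0 mul0r subr0.
have yE : y = alpha *: (e * p) + alpha^* *: (e * p').
  rewrite -h11 -h22 -[LHS]yq -{1}qy mulrDl !mulrDr !mulrDl h21 h12 b0 conjC0 !scale0r.
  by rewrite addr0 add0r.
have /orP[/eqP a0|/eqP a1] : (alpha == 0) || (alpha == 1).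
- by rewrite -[alpha == 1]subr_eq0 -mulf_eq0 mulrBr mulr1 aa subrr.
- by left; rewrite yE a0 conjC0 !scale0r addr0.
- by right; rewrite yE a1 conjC1 !scale1r mulrDl ep ep'.
Qed.

End QuaternionicCorner.

Section RealCorner.
Variables (K : numFieldType) (A : algType K) (p p' e J : A) (d : K).
Hypotheses (pp : p * p = p) (pp' : p' * p' = p') (p0 : p * p' = 0) (p'0 : p' * p = 0).
Hypotheses (ee : e * e = e) (ep : e * p = p * e) (ep' : e * p' = p' * e) (eJ : e * J = J * e).
Hypotheses (Jp : J * p = p' * J) (Jp' : J * p' = p * J) (JJ : J * J = 1) (dd : d * d = 1).

Definition half_proj (c : K) : A := 2^-1 *: (1 + c *: J).

Lemma half_projE c : half_proj d * half_proj c =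
  (2^-1 * 2^-1) *: ((1 + c *: J) + d *: (J + c *: 1)).
Proof.
rewrite /half_proj -scalerAl -scalerAr scalerA mulrDl mul1r -scalerAl mulrDr mulr1 -scalerAr JJ.
by [].
Qed.

Lemma half_proj_idem : half_proj d * half_proj d = half_proj d.
Proof.
rewrite half_projE [d *: (_ + _)]scalerDr [d *: (d *: _)]scalerA dd scale1r [_ + 1]addrC -mulr2n -scaler_nat scalerA.
by rewrite -mulrA mulVf ?mulr1 // pnatr_eq0.
Qed.

Lemma half_proj_orth : half_proj d * half_proj (- d) = 0.
Proof.
rewrite half_projE scaleNr [d *: (_ + _)]scalerDr scalerA mulrN dd scaleN1r addrA subrK subrr.
by rewrite scaler0.
Qed.

Lemma half_proj_comm x c : x * J = J * x -> x * half_proj c = half_proj c * x.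
Proof.
by move=> h; rewrite /half_proj -scalerAr -scalerAl mulrDr mulrDl mulr1 mul1r -scalerAr -scalerAl h.
Qed.

Let hp := half_proj d.
Let q := p + p'.
Definition corner_proj : A := q * hp * e.
Notation u := corner_proj.

Let qJ : q * J = J * q. Proof. by rewrite /q mulrDl mulrDr Jp Jp' addrC. Qed.
Let qq : q * q = q. Proof. by rewrite /q mulrDl !mulrDr pp pp' p0 p'0 addr0 add0r. Qed.
Let eq : e * q = q * e. Proof. by rewrite /q mulrDl mulrDr ep ep'. Qed.
Let ehp : e * hp = hp * e. Proof. by rewrite /hp half_proj_comm. Qed.
Let qhp : q * hp = hp * q. Proof. by rewrite /hp half_proj_comm. Qed.
Let Jhp : J * hp = d *: hp.
Proof.
rewrite /hp /half_proj -scalerAr mulrDr mulr1 -scalerAr JJ scalerA mulrC -scalerA; congr (_ *: _).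
by rewrite scalerDr scalerA dd scale1r addrC.
Qed.

Lemma corner_proj_idem : u * u = u.
Proof.
rewrite /u -(mulrA (q * hp) e) (mulrA e) (mulrA e q hp) eq -(mulrA q e) ehp !mulrA -(mulrA _ e e) ee.
by rewrite -(mulrA q hp q) -qhp mulrA qq -(mulrA q hp hp) /hp half_proj_idem.
Qed.

Let Ju : J * u = d *: u.
Proof. by rewrite /u !mulrA -qJ -(mulrA q J hp) Jhp -scalerAr -!scalerAl. Qed.
Let uJ : u * J = d *: u.
Proof.
rewrite /u -mulrA eJ !mulrA -(mulrA q hp J) -[hp * J](half_proj_comm d (erefl (J * J))) Jhp.
by rewrite -scalerAr -!scalerAl.
Qed.
Let qu : q * u = u. Proof. by rewrite /u !mulrA qq. Qed.
Let uq : u * q = u.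
Proof. by rewrite /u -mulrA eq mulrA -(mulrA q hp q) -qhp mulrA qq. Qed.

Lemma corner_proj_compress : p * u * p = 2^-1 *: (e * p).
Proof.
have pq : p * q = p by rewrite /q mulrDr pp p0 addr0.
rewrite /u !mulrA pq -mulrA ep !mulrA.
rewrite /hp /half_proj -scalerAr mulrDr mulr1 -scalerAr -!scalerAl; congr (_ *: _).
by rewrite !mulrDl -!scalerAl pp -(mulrA p J p) Jp mulrA p0 !mul0r scaler0 addr0.
Qed.

(** J acts on both sides of this corner as the scalar d, and J exchanges p and p', so an element of
    the corner is determined by its p-block alone. *)
Lemma real_corner (y : A) (a : K) : u * y = y -> y * u = y -> y * y = y -> e * y = y ->
  e * (p * y * p) = a *: (e * p) -> y = 0 \/ y = u.
Proof.
move=> uy yu yy ey ha.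
have h11 : p * y * p = a *: (e * p) by rewrite -ha !mulrA ep -(mulrA p e y) ey.
(* The p-block of u is half of e p, so the factor 2 a makes that of z vanish. *)
pose z := y - (2 * a) *: u.
have Jz : J * z = d *: z.
  by rewrite /z mulrBr -scalerAr -{1}uy mulrA Ju -scalerAl uy scalerBr !scalerA mulrC.
have zJ : z * J = d *: z.
  by rewrite /z mulrBl -scalerAl -{1}yu -mulrA uJ -scalerAr yu scalerBr !scalerA mulrC.
have qz : q * z = z by rewrite /z mulrBr -scalerAr qu -{1}uy mulrA qu uy.
have zq : z * q = z by rewrite /z mulrBl -scalerAl uq -{1}yu -mulrA uq yu.
have z11 : p * z * p = 0.
  rewrite /z mulrBr mulrBl h11 -scalerAr -scalerAl corner_proj_compress scalerA.
  by rewrite -mulrA (mulrC a) mulrA mulfV ?mul1r ?subrr // pnatr_eq0.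
have zE : z = d *: (J * z) by rewrite Jz scalerA dd scale1r.
have zE' : z = d *: (z * J) by rewrite zJ scalerA dd scale1r.
have z21 : p' * z * p = 0.
  by rewrite zE -scalerAr -scalerAl mulrA -Jp -!mulrA (mulrA p) z11 mulr0 scaler0.
have zp : z * p = 0 by rewrite -qz mulrDl mulrDl z11 z21 addr0.
have zp' : z * p' = 0 by rewrite zE' -scalerAl -mulrA Jp' mulrA zp mul0r scaler0.
have z0 : z = 0 by rewrite -zq mulrDr zp zp' addr0.
apply: (scale_idem corner_proj_idem _ yy (c := 2 * a)).
by apply/eqP; rewrite -subr_eq0 -/z z0.
Qed.

End RealCorner.

(** * Primitivity of weights, pairs of weights and signed pairs *)

Section Idempotents.
Variables (C : numClosedFieldType) (n : nat).
Hypothesis n0 : (0 < n)%N.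
Notation A := (talg C n).
Notation P := (@Pw C n).

Lemma PT_scale (K : fieldType) (c : 'I_n -> K) (f : 'I_n -> qalg K) :
  PT (fun m => c m *: f m) = (\prod_m c m) *: PT f.
Proof.
by apply/ffunP => w; rewrite !ffunE /GRing.scale /= -big_split; apply: eq_bigr => m _; rewrite ffunE.
Qed.

Definition Jop : A := PT (fun _ => q2).

Lemma Jop_sqr : Jop * Jop = (-1) ^+ n *: 1.
Proof.
rewrite PTM (@eq_PT _ _ _ (fun _ => (-1) *: 1)) => [|m]; last by rewrite q22 scaleN1r.
by rewrite PT_scale prodr_const card_ord.
Qed.

Lemma symm_Jop : symm Jop.
Proof. by move=> s; rewrite tpPT. Qed.

Lemma Jop_PA S : Jop * PA C S = PA C (~: S) * Jop.
Proof.
rewrite !PTM; apply: eq_PT => m; rewrite inE; case: (m \in S) => /=; by rewrite ?q2A ?q2B.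
Qed.

Lemma Jop_Pw k : (k <= n)%N -> Jop * P k = P (n - k) * Jop.
Proof.
move=> kn; rewrite /Pw mulr_sumr mulr_suml [RHS](reindex_inj (@setC_inj _)) /=.
apply: eq_big => [S|S _]; last exact: Jop_PA.
have := cardsC S; rewrite card_ord; move: #|_| #|_| => a b hab.
by apply/eqP/eqP; lia.
Qed.

(** Its fixed points are the tensors with real coordinates. As a and a^c are conjugate, it sends P_k
    to P_(n-k). *)
Definition cj (x : A) : A := tmap (Num.conj : {rmorphism C -> C}) x.

Lemma qmap_conj_qA : qmap (Num.conj : {rmorphism C -> C}) (qA C) = qB C.
Proof.
apply/ffunP => i; rewrite !ffunE /GRing.scale /= rmorphM rmorphD rmorphM /= conjCi.
by rewrite fmorphV !rmorph_nat mulNr.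
Qed.

Lemma qmap_conj_qB : qmap (Num.conj : {rmorphism C -> C}) (qB C) = qA C.
Proof.
apply/ffunP => i; rewrite !ffunE /GRing.scale /= rmorphM rmorphB rmorphM /= conjCi.
by rewrite fmorphV !rmorph_nat mulNr opprK.
Qed.

Lemma cj_PA S : cj (PA C S) = PA C (~: S).
Proof.
apply/ffunP => w; rewrite !ffunE rmorph_prod; apply: eq_bigr => m _; rewrite inE.
by case: (m \in S); [rewrite -qmap_conj_qA [RHS]ffunE | rewrite -qmap_conj_qB [RHS]ffunE].
Qed.

Lemma cj_Pw k : (k <= n)%N -> cj (P k) = P (n - k).
Proof.
move=> kn; rewrite /cj /Pw tmap_sum [RHS](reindex_inj (@setC_inj _)) /=.
apply: eq_big => [S|S _]; last exact: cj_PA.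
have := cardsC S; rewrite card_ord; move: #|_| #|_| => a b hab.
by apply/eqP/eqP; lia.
Qed.

Lemma cj_Jop : cj Jop = Jop.
Proof. exact: tmap_qe. Qed.

Lemma symm_Om : symm (Om C n).
Proof. by apply: symmZ; apply: sy_symm. Qed.

Variable l : nat.
Hypothesis hl : (uphalf n <= l <= n)%N.
Notation e := (eC C n l).

Lemma symm_eC : symm e.
Proof.
rewrite eC_el // /el; move: (lagr _ _ _) => q; elim/poly_ind: q => [|q c IH].
  by rewrite rmorph0 => s; rewrite linear0.
rewrite rmorphD rmorphM /= horner_algX horner_algC.
by apply: symmD; [apply: symmM => //; apply: symm_Om | apply: symmZ; apply: symm1].
Qed.

Lemma inS_symm (y : A) : inS l y -> symm y /\ e * y = y.
Proof.
move=> [s [ss ->]]; have ss' : symm (s : A) by [].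
have -> : tmul s (eid n l) = (s : A) * e by [].
split; first by apply: symmM => //; apply: symm_eC.
by rewrite mulrA eC_comm // -mulrA eC_idem.
Qed.

Lemma symm_inS (x : A) : symm x -> inS l (x * e).
Proof. by move=> sx; exists x. Qed.

Lemma eC_Pw k : e * P k = P k * e.
Proof. by rewrite eC_comm //; apply: symm_Pw. Qed.

Lemma Pw_idem k : P k * P k = P k. Proof. by rewrite Pw_mul eqxx. Qed.
Lemma Pw_orth j k : j != k -> P j * P k = 0. Proof. by move=> jk; rewrite Pw_mul (negPf jk). Qed.

Lemma wt_idem k : (P k * e) * (P k * e) = P k * e.
Proof. by rewrite -mulrA [e * _]mulrA eC_Pw -mulrA mulrA Pw_idem eC_idem. Qed.

Lemma wt_neq0 k : (n - l <= k <= l)%N -> P k * e <> 0.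
Proof. by move=> hk; rewrite -eC_Pw; apply/eqP; apply: eC_weight_neq0. Qed.

Lemma wt_corner k (y : A) : (k <= n)%N -> inS l y -> y * y = y ->
  (P k * e) * y = y -> y * (P k * e) = y -> y = 0 \/ y = P k * e.
Proof.
move=> kn /inS_symm[sy ey] yy xy yx.
have [c hc] := corner n0 hl sy kn.
apply: (scale_idem (wt_idem k) (c := c)) => //.
rewrite -eC_Pw -hc; rewrite -{1}xy -{1}yx -[P k * e]eC_Pw !mulrA.
have ye : y * e = y by rewrite -eC_comm.
by rewrite -(mulrA (e * P k) y e) ye.
Qed.

Lemma prim_weight k : (n - l <= k <= l)%N -> prim_idem l (P k * e).
Proof.
move=> hk; have ln : (l <= n)%N by case/andP: hl.
apply: prim_idem_intro.
- exact/symm_inS/symm_Pw.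
- exact: wt_idem.
- exact: wt_neq0.
- by move=> y Sy yy xy yx; apply: wt_corner => //; lia.
Qed.

Definition wpair k : A := (P k + P (n - k)) * e.

Lemma wpair_idem k : k != (n - k)%N -> wpair k * wpair k = wpair k.
Proof.
move=> kk; have kk' : (n - k)%N != k by rewrite eq_sym.
rewrite /wpair -mulrA [e * _]mulrA; have -> : e * (P k + P (n - k)) = (P k + P (n - k)) * e.
  by rewrite mulrDl mulrDr !eC_Pw.
rewrite -mulrA mulrA eC_idem // mulrDl !mulrDr !Pw_idem !Pw_orth //.
by rewrite addr0 add0r.
Qed.

Lemma wpair_neq0 k : k != (n - k)%N -> (n - l <= k <= l)%N -> wpair k <> 0.
Proof.
move=> kk hk h; apply: (wt_neq0 hk); have := congr1 (fun z => P k * z) h.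
by rewrite /wpair mulr0 mulrA mulrDr Pw_idem Pw_orth // addr0.
Qed.

Lemma symm_wpair0 k : symm (P k + P (n - k)).
Proof. by apply: symmD; apply: symm_Pw. Qed.

Lemma wpair_orth j k : (j <= n)%N -> (k <= n)%N -> j != k -> j != (n - k)%N -> wpair j * wpair k = 0.
Proof.
move=> jn kn jk jk'; rewrite /wpair -mulrA [e * _]mulrA eC_comm //; last exact: symm_wpair0.
rewrite -mulrA mulrA mulrDl !mulrDr !Pw_orth ?addr0 ?mul0r //; lia.
Qed.

(** The condition [cj y = y] is essential: over C the pair splits into P_k e and P_(n-k) e. *)
Lemma wpair_corner k (y : A) : odd n -> (n - l <= k <= l)%N -> k != (n - k)%N ->
  inS l y -> cj y = y -> y * y = y -> wpair k * y = y -> y * wpair k = y -> y = 0 \/ y = wpair k.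
Proof.
move=> on hk kk /inS_symm[sy ey] cy yy Qy yQ; have ln : (l <= n)%N by case/andP: hl.
have kn : (k <= n)%N by lia.
have kk' : (n - k)%N != k by rewrite eq_sym.
have [a ha] := corner n0 hl sy kn.
have [b hb] := corner n0 hl (symmM symm_Jop sy) kn.
apply: (@quaternionic_corner C A cj (P k) (P (n - k)) e Jop y _ _ _ _ _ _ _ _ _ _ _ _ _ _ _ _ _ _ _ _ _ a b ha hb) => //.
- exact: Pw_idem.
- exact: Pw_idem.
- exact: eC_idem.
- exact: eC_Pw.
- exact: eC_Pw.
- by rewrite eC_comm //; apply: symm_Jop.
- exact: Jop_Pw.
- by rewrite Jop_Pw ?leq_subr // subKn.
- by rewrite Jop_sqr -signr_odd on expr1 scaleN1r.
- exact: eC_weight_neq0.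
- by move=> x z; apply: tmapM.
- by move=> c x; apply: tmapZ.
- exact: cj_Pw.
- by rewrite cj_Pw ?leq_subr // subKn.
- exact: tmap_eid.
- exact: cj_Jop.
- by move: Qy; rewrite /wpair -mulrA ey.
- rewrite -{2}yQ /wpair mulrA -[RHS]eC_comm ?mulrA ?ey //.
  exact: symmM sy (symm_wpair0 k).
Qed.

Definition signed_pair k (d : C) : A := corner_proj (P k) (P (n - k)) e Jop d.

Lemma symm_signed_pair0 k d : symm ((P k + P (n - k)) * (2^-1 *: (1 + d *: Jop))).
Proof.
apply: symmM; first exact: symm_wpair0.
by apply/symmZ/symmD; [exact: symm1 | apply/symmZ/symm_Jop].
Qed.

Lemma Jop_involutive : ~~ odd n -> Jop * Jop = 1.
Proof. by move=> en; rewrite Jop_sqr -signr_odd (negPf en) scale1r. Qed.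

Lemma signed_pair_prim k d : ~~ odd n -> (n - l <= k <= l)%N -> k != (n - k)%N -> d * d = 1 ->
  prim_idem l (signed_pair k d).
Proof.
move=> en hk kk dd; have ln : (l <= n)%N by case/andP: hl.
have kn : (k <= n)%N by lia.
have kk' : (n - k)%N != k by rewrite eq_sym.
have eJ : e * Jop = Jop * e by rewrite eC_comm //; apply: symm_Jop.
have Jp' : Jop * P (n - k) = P k * Jop by rewrite Jop_Pw ?leq_subr // subKn.
have ee := eC_idem C n0 hl.
apply: prim_idem_intro.
- exact/symm_inS/symm_signed_pair0.
- exact: (corner_proj_idem (Pw_idem k) (Pw_idem (n - k)) (Pw_orth kk) (Pw_orth kk') ee (eC_Pw k) (eC_Pw (n - k)) eJ
    (Jop_Pw kn) Jp' (Jop_involutive en) dd).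
- move=> h; have := corner_proj_compress d (Pw_idem k) (Pw_orth kk) (eC_Pw k) (Jop_Pw kn).
  rewrite -/(signed_pair k d) h mulr0 mul0r => /esym/eqP; rewrite scaler_eq0 invr_eq0 pnatr_eq0 /=.
  by apply/negP; apply: eC_weight_neq0.
- move=> y /[dup] Sy /inS_symm[sy ey] yy uy yu; have [a ha] := corner n0 hl sy kn.
  exact: (real_corner (Pw_idem k) (Pw_idem (n - k)) (Pw_orth kk) (Pw_orth kk') ee (eC_Pw k) (eC_Pw (n - k)) eJ
    (Jop_Pw kn) Jp' (Jop_involutive en) dd uy yu yy ey ha).
Qed.

Lemma wpair0_half k d : (k <= n)%N ->
  (P k + P (n - k)) * half_proj Jop d = half_proj Jop d * (P k + P (n - k)).
Proof.
move=> kn; apply: half_proj_comm; rewrite mulrDl mulrDr !Jop_Pw ?leq_subr // subKn //.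
by rewrite addrC.
Qed.

Lemma wpair0_orth j k : (j <= n)%N -> (k <= n)%N -> j != k -> j != (n - k)%N ->
  (P j + P (n - j)) * (P k + P (n - k)) = 0.
Proof. by move=> jn kn jk jk'; rewrite mulrDl !mulrDr !Pw_orth ?addr0 //; lia. Qed.

Lemma signed_pair_mul j k d c : (j <= n)%N -> (k <= n)%N -> signed_pair j d * signed_pair k c =
  (P j + P (n - j)) * (P k + P (n - k)) * (half_proj Jop d * half_proj Jop c) * e.
Proof.
move=> jn kn; rewrite /signed_pair /corner_proj.
rewrite -[_ * e * _]mulrA [e * (_ * e)]mulrA eC_comm //; last exact: symm_signed_pair0.
rewrite -[_ * e * e]mulrA eC_idem // !mulrA; congr (_ * e).
by rewrite -[_ * half_proj Jop d * (P k + _)]mulrA -wpair0_half // mulrA.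
Qed.

Lemma signed_pair_orth j k d c : (j <= n)%N -> (k <= n)%N -> j != k -> j != (n - k)%N ->
  signed_pair j d * signed_pair k c = 0.
Proof. by move=> jn kn jk jk'; rewrite signed_pair_mul // wpair0_orth // !mul0r. Qed.

Lemma signed_pair_opp k d : ~~ odd n -> (k <= n)%N -> d * d = 1 -> signed_pair k d * signed_pair k (- d) = 0.
Proof. by move=> en kn dd; rewrite signed_pair_mul // half_proj_orth ?mulr0 ?mul0r // Jop_involutive. Qed.

Lemma signed_pair_mid k d h : (k <= n)%N -> (h <= n)%N -> k != h -> (n - k)%N != h ->
  signed_pair k d * (P h * e) = 0 /\ (P h * e) * signed_pair k d = 0.
Proof.
move=> kn hn kh kh'; have z : (P k + P (n - k)) * P h = 0.
  by rewrite mulrDl !Pw_orth // addr0.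
have z' : P h * (P k + P (n - k)) = 0.
  by rewrite mulrDr !Pw_orth ?addr0 // eq_sym.
rewrite /signed_pair /corner_proj; split.
  by rewrite wpair0_half // -eC_Pw // !mulrA -(mulrA _ e e) eC_idem // -(mulrA _ e) eC_Pw // mulrA
     -(mulrA (half_proj _ _)) z mulr0 mul0r.
by rewrite -eC_Pw // -(mulrA e) !mulrA -(mulrA e) z' mulr0 !mul0r.
Qed.

Lemma signed_pair_sum k : signed_pair k (-1) + signed_pair k 1 = wpair k.
Proof.
rewrite /signed_pair /corner_proj -mulrDl -mulrDr /half_proj -scalerDr scaleN1r scale1r addrACA addNr addr0.
by rewrite -mulr2n -scaler_nat scalerA mulVf ?pnatr_eq0 // scale1r mulr1.
Qed.

End Idempotents.

(** * Waring's formula and symmetrization *)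

Section Waring.
Variable R : comNzRingType.

(* [wco N i] is the integer [N / (N - i) * 'C(N - i, i)]. *)
Definition wco (N i : nat) : nat :=
  'C(N - i, i) + (if i is j.+1 then 'C((N - i).-1, j) else 0).

Definition wterm (s t : R) (N i : nat) : R :=
  if (2 * i <= N)%N then (wco N i)%:R * (- (s * t)) ^+ i * (s + t) ^+ (N - 2 * i) else 0.

(** The recurrence of the power sums s^N + t^N, term by term; for the coefficients it is Pascal's
    rule. It fails from N = 0, where [wco] gives 1 but the power sum is 2. *)
Lemma wtermS s t N i : (0 < N)%N ->
  wterm s t N.+2 i.+1 = (s + t) * wterm s t N.+1 i.+1 - s * t * wterm s t N i.
Proof.
move=> N0; rewrite /wterm (_ : (2 * i.+1 <= N.+2) = (2 * i <= N))%N; last by lia.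
case: (leqP (2 * i) N) => iN; last by rewrite ifF ?mulr0 ?subr0 //; lia.
have gE : wco N.+2 i.+1 = (wco N.+1 i.+1 + wco N i)%N.
  rewrite /wco; case: i iN => [|j] jN; first by rewrite !subn0 !bin1 !bin0 !subn1; lia.
  have [r hr] : exists r, (N = r + j.+2)%N by exists (N - j.+2)%N; lia.
  subst N.
  have -> : ((r + j.+2).+2 - j.+2 = r.+2)%N by lia.
  have -> : ((r + j.+2).+1 - j.+2 = r.+1)%N by lia.
  have -> : (r + j.+2 - j.+1 = r.+1)%N by lia.
  by rewrite /= !binS; lia.
have -> : (N.+2 - 2 * i.+1 = N - 2 * i)%N by lia.
case: (leqP (2 * i.+1) N.+1) => iN1.
  have -> : (N - 2 * i = (N.+1 - 2 * i.+1).+1)%N by lia.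
  rewrite gE natrD !exprS; move: (_ ^+ i) (_ ^+ (_ - _)) => x y; ring.
(* Boundary case N = 2i: the term of order N+1 is out of range, in accordance with a zero
   coefficient. *)
have -> : (N - 2 * i = 0)%N by lia.
rewrite gE (_ : wco N.+1 i.+1 = 0)%N; last first.
  by rewrite /wco !bin_small //; lia.
rewrite exprS; move: (_ ^+ i) => x; ring.
Qed.

(** Both N = 1 and N = 2 are base cases, as the recurrence cannot start at 0. Terms beyond N/2 are
    zero, so any large enough B is allowed. *)
Lemma waring s t N B : (0 < N)%N -> (N < 2 * B)%N ->
  \sum_(i < B) wterm s t N i = s ^+ N + t ^+ N.
Proof.
have [M] := ubnP N; elim: M N B => // M IH N B NM N0 NB.
case: B NB => [|B] NB; first by lia.
case: N N0 NM NB => [//|[|[|N]]] _ NM NB.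
- rewrite big_ord_recl big1 ?addr0 => [|i _]; last by rewrite /wterm ifF // !lift0; lia.
  by rewrite -[wterm s t 1 _]/(1%:R * 1 * (s + t) ^+ 1) !expr1 mulr1 mul1r.
- case: B NB => [|B] NB; first by lia.
  rewrite !big_ord_recl big1 ?addr0 => [|i _]; last by rewrite /wterm ifF // !lift0; lia.
  rewrite -[wterm s t 2 ord0]/(1%:R * 1 * (s + t) ^+ 2) [nat_of_ord _]lift0.
  by rewrite -[wterm s t 2 1]/(2%:R * (- (s * t)) ^+ 1 * (s + t) ^+ 0); ring.
rewrite big_ord_recl.
under eq_bigr => i _ do rewrite lift0 wtermS //.
rewrite sumrB -!mulr_sumr IH //; [|lia|lia].
have -> : wterm s t N.+3 0 = (s + t) * wterm s t N.+2 0.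
  by rewrite /wterm /wco !muln0 !subn0 !bin0 /= !exprS; ring.
have := IH N.+2 B.+1; rewrite big_ord_recl; under eq_bigr => i _ do rewrite lift0.
move=> /(_ _ isT) h; rewrite addrA -mulrDr h; [|lia|lia].
rewrite !exprS; ring.
Qed.

End Waring.

(** Absorption: i 'C(N-i, i) = (N-i) 'C(N-i-1, i-1). *)
Lemma wcoE (K : numFieldType) N i : (0 < N)%N -> (2 * i <= N)%N ->
  (wco N i)%:R = N%:R * 'C(N - i, i)%:R / (N - i)%:R :> K.
Proof.
move=> N0 iN; have h : (N - i)%:R != 0 :> K by rewrite pnatr_eq0; lia.
apply/eqP; rewrite eq_sym (can2_eq (divfK h) (mulfK h)) -!natrM eqr_nat; apply/eqP.
rewrite /wco; case: i iN {h} => [|j] jN; first by rewrite subn0 addn0 mulnC.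
have [r hr] : exists r, (N - j.+1 = r.+1)%N by exists (N - j.+2)%N; lia.
rewrite hr /=; have -> : N = (r.+1 + j.+1)%N by lia.
have := mul_bin_diag r.+1 j; rewrite /=; move: ('C(r, j)) ('C(r.+1, j.+1)) => x y; lia.
Qed.

Section Symbols.
Variable C : numClosedFieldType.

Definition bt n (s : bitseq) : tens C n :=
  ptens n (fun m => if nth false s m then qA C else qB C).

(* A word with k letters a and n - k letters a^c is recorded as 'X^k; symmetrization
   forgets the rest of the word. *)
Definition symb n (x : tens C n) (q : {poly C}) := exists L : seq (C * bitseq),
  [/\ all (fun cs => size cs.2 == n) L, x = \sum_(cs <- L) cs.1 *: bt n cs.2 &
      q = \sum_(cs <- L) cs.1 *: 'X^(count id cs.2)].

Lemma symb_bt n s : size s = n -> symb (bt n s) 'X^(count id s).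
Proof.
by move=> h; exists [:: (1, s)]; rewrite /= h eqxx !big_seq1 /= !scale1r.
Qed.

Lemma symbD n (x y : tens C n) q r : symb x q -> symb y r -> symb (x + y) (q + r).
Proof.
move=> [L [hL -> ->]] [M [hM -> ->]]; exists (L ++ M).
by rewrite all_cat hL hM !big_cat.
Qed.

Lemma symbZ n (x : tens C n) q a : symb x q -> symb (a *: x) (a *: q).
Proof.
move=> [L [hL -> ->]]; exists [seq (a * cs.1, cs.2) | cs <- L].
rewrite all_map; split=> //; rewrite big_map scaler_sumr; apply: eq_bigr => cs _.
  by rewrite scalerA.
by rewrite scalerA.
Qed.

Lemma ttens_bt n m p s t : (m + p)%N = n -> size s = m ->
  ttens (bt m s) (bt p t) = bt n (s ++ t).
Proof.
move=> mpn sm; rewrite /bt ttens_ptens //; apply: eq_ptens => i.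
by rewrite nth_cat sm; case: ltnP.
Qed.

Lemma symb_ttens n m p (x : tens C m) (y : tens C p) q r : (m + p)%N = n ->
  symb x q -> symb y r -> symb (ttens x y : tens C n) (q * r).
Proof.
move=> mpn [L [hL -> ->]] [M [hM -> ->]].
exists [seq (c.1 * d.1, c.2 ++ d.2) | c <- L, d <- M]; split.
- apply/allP => z /allpairsP[[c d] /= [cL dM ->]] /=.
  by rewrite size_cat (eqP (allP hL c cL)) (eqP (allP hM d dM)) mpn.
- rewrite [RHS]big_allpairs_dep ttens_suml big_seq [RHS]big_seq; apply: eq_bigr => c cL.
  rewrite ttensZl ttens_sumr scaler_sumr; apply: eq_bigr => d _.
  by rewrite ttensZr scalerA ttens_bt //; apply/eqP/(allP hL).
- rewrite [RHS]big_allpairs_dep mulr_suml; apply: eq_bigr => c _; rewrite mulr_sumr.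
  by apply: eq_bigr => d _; rewrite count_cat exprD -scalerAl -scalerAr scalerA.
Qed.

Lemma symb_eq n (x : tens C n) q r : symb x q -> q = r -> symb x r.
Proof. by move=> h <-. Qed.

Lemma tone1E : tone 1 = bt 1 [:: true] + bt 1 [:: false].
Proof.
apply/ffunP => w; rewrite !ffunE !big_ord1 /=.
by have /ffunP/(_ (w ord0)) := qA_add_qB C; rewrite !ffunE.
Qed.

Lemma symb_tone n : symb (tone n) ((1 + 'X) ^+ n).
Proof.
elim: n => [|n IH].
  have -> : tone 0 = bt 0 [::] by apply/ffunP => w; rewrite !ffunE !big_ord0.
  exact: symb_bt.
have -> : tone n.+1 = ttens (tone 1) (tone n) :> tens C n.+1.
  by rewrite /tone ttens_ptens //; apply: eq_ptens => i; case: ltnP.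
rewrite exprS; apply: symb_ttens => //; rewrite tone1E.
apply: symb_eq (symbD (symb_bt _) (symb_bt _)) _ => //=.
by rewrite expr1 expr0 addrC.
Qed.

Lemma symb_tpow m (x : tens C m) q j L : symb x q -> L = (j * m)%N ->
  symb (tpow x j L) (q ^+ j).
Proof.
move=> hx; elim: j L => [|j IH] L -> /=.
  have -> : [ffun=> (0 * m == 0)%:R] = bt (0 * m) [::].
    by rewrite mul0n; apply/ffunP => w; rewrite !ffunE !big_ord0.
  exact: symb_bt.
rewrite exprS; apply: symb_ttens => //; first by rewrite mulSn addKn.
by apply: IH; rewrite mulSn addKn.
Qed.

(** 1 = a + a^c and e_1 = -i (a - a^c), so in the half-sum of the two tensor squares only the mixed
    terms remain. *)
Lemma tsqE : tsq = bt 2 [:: true; false] + bt 2 [:: false; true].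
Proof.
have key (x y z t j : C) : j * j = -1 -> 2^-1 * (x * z + y * t) =
    2^-1 * (x + j * y) * (2^-1 * (z - j * t)) + 2^-1 * (x - j * y) * (2^-1 * (z + j * t)).
  move=> jj; have -> : forall h : C, h * (x + j * y) * (h * (z - j * t)) +
    h * (x - j * y) * (h * (z + j * t)) = h * (h * 2) * (x * z - j * j * (y * t)).
    by move=> h; ring.
  by rewrite jj mulN1r opprK mulVf ?mulr1 // pnatr_eq0.
apply/ffunP => w; rewrite !ffunE !big_ord_recl !big_ord0 /= !mulr1 !ffunE /GRing.scale /=.
by apply: key; rewrite -expr2 sqrCi.
Qed.

Lemma symb_tsq : symb tsq (2 *: 'X).
Proof.
rewrite tsqE; apply: symb_eq (symbD (symb_bt _) (symb_bt _)) _ => //=.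
by rewrite expr1 scaler_nat mulr2n.
Qed.

Lemma symb_cotsq : symb (tone 2 - tsq) (1 + 'X ^+ 2).
Proof.
rewrite -scaleN1r; apply: symb_eq (symbD (symb_tone 2) (symbZ _ symb_tsq)) _.
rewrite scaleN1r scaler_nat; ring.
Qed.

End Symbols.

(** The indicator tuples of S and T contain equally many [true], so each is a rearrangement of the
    other. *)
Lemma card_perm_sets (n : nat) (S T : {set 'I_n}) : #|S| = #|T| ->
  exists s : {perm 'I_n}, s @: S = T.
Proof.
move=> ST; pose tup (U : {set 'I_n}) := [tuple m \in U | m < n].
have cnt U : count id (tup U) = #|U|.
  by rewrite -sum1_card -sum1_count /= big_map big_enum_cond.
have : perm_eq (tup S) (tup T).
  apply/allP => b _; have E U : count_mem b (tup U) = if b then #|U| else (n - #|U|)%N.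
    case: b; first by rewrite -cnt; apply: eq_count => -[].
    have := count_predC id (tup U); rewrite size_tuple cnt => h.
    by rewrite (eq_count (_ : _ =1 predC id)) => [|[]//]; lia.
  by rewrite /= !E ST.
case/tuple_permP => s hs; exists s; apply/setP => j.
rewrite -[j](permKV s) (mem_imset _ _ (@perm_inj _ s)).
have := congr1 (fun r => nth false r (s^-1%g j)) hs.
rewrite -!tnth_nth !tnth_mktuple //.
Qed.

Section SymbolAverage.
Variables (C : numClosedFieldType) (n : nat).

Lemma sy_PA (S : {set 'I_n}) : sy (PA C S) = 'C(n, #|S|)%:R^-1 *: Pw C n #|S|.
Proof.
have bn0 : 'C(n, #|S|)%:R != 0 :> C.
  by rewrite pnatr_eq0 -lt0n bin_gt0 -[X in (_ <= X)%N](card_ord n) max_card.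
suff -> : Pw C n #|S| = 'C(n, #|S|)%:R *: sy (PA C S) by rewrite scalerA mulVf // scale1r.
rewrite -[LHS]sy_id; last exact: symm_Pw.
rewrite /Pw linear_sum (eq_bigr (fun=> sy (PA C S))) => [|T /eqP TS].
  by rewrite sumr_const scaler_nat -[X in 'C(X, _)](card_ord n) -card_draws cardsE.
have [s <-] := card_perm_sets (esym TS); by rewrite -tp_PA /= sy_tp.
Qed.

Lemma sy_bt s : size s = n ->
  sy (bt C n s : talg C n) = 'C(n, count id s)%:R^-1 *: Pw C n (count id s).
Proof.
move=> sn; have -> : count id s = #|[set m : 'I_n | nth false s m]|.
  by rewrite -sum1_card -sum1_count (big_nth false) sn big_mkord; apply: eq_bigl => i; rewrite inE.
by rewrite -sy_PA; congr sy; apply: eq_PT => m; rewrite inE.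
Qed.

(** Sends 'X^k, for k <= n, to the common average of all words with k letters a; thus it recovers an
    average from a symbol ([symb_sy]). *)
Definition Psi (q : {poly C}) : talg C n :=
  \sum_(k < n.+1) (q`_k / 'C(n, k)%:R) *: Pw C n k.

Lemma Psi_is_linear : linear Psi.
Proof.
move=> a q r; rewrite /Psi scaler_sumr -big_split; apply: eq_bigr => k _ /=.
by rewrite coefD coefZ mulrDl scalerDl scalerA mulrA.
Qed.
HB.instance Definition _ := GRing.isLinear.Build C {poly C} (talg C n) _ Psi Psi_is_linear.

Lemma PsiXn k : (k <= n)%N -> Psi 'X^k = 'C(n, k)%:R^-1 *: Pw C n k.
Proof.
move=> kn; rewrite /Psi (bigD1 (Ordinal (kn : k < n.+1)%N)) //= coefXn eqxx mul1r.
rewrite big1 ?addr0 // => j jk; rewrite coefXn.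
by rewrite -[(j : nat) == k]/(j == Ordinal (kn : k < n.+1)%N) (negPf jk) mul0r scale0r.
Qed.

Lemma symb_sy (x : tens C n) q : symb x q -> sy (x : talg C n) = Psi q.
Proof.
move=> [L [hL -> ->]]; rewrite [LHS]linear_sum [RHS]linear_sum.
rewrite big_seq [RHS]big_seq; apply: eq_bigr => cs csL.
have hs : size cs.2 = n by apply/eqP/(allP hL).
rewrite [LHS]linearZ [RHS]linearZ /= sy_bt // PsiXn //.
by rewrite -hs count_size.
Qed.

Lemma Psi_single k : (k <= n)%N -> Psi ('C(n, k)%:R *: 'X^k) = Pw C n k.
Proof.
move=> kn; rewrite linearZ /= PsiXn // scalerA mulfV ?scale1r //.
by rewrite pnatr_eq0 -lt0n bin_gt0.
Qed.

Lemma Psi_pair k : (2 * k <= n)%N ->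
  Psi ('C(n, k)%:R *: ('X^k * ('X^(n - 2 * k) + 1))) = Pw C n k + Pw C n (n - k).
Proof.
move=> kn; have -> : 'X^k * ('X^(n - 2 * k) + 1) = 'X^(n - k) + 'X^k :> {poly C}.
  by rewrite mulrDr mulr1 -exprD; congr ('X^_ + _); lia.
rewrite scalerDr linearD /= addrC; congr (_ + _); first by rewrite Psi_single //; lia.
by rewrite -bin_sub ?Psi_single ?leq_subr //; lia.
Qed.

Lemma PsiZsum (c : C) m (a : 'I_m -> C) (q : 'I_m -> {poly C}) :
  c *: \sum_i (a i *: Psi (q i)) = Psi (\sum_i (c * a i) *: q i).
Proof.
rewrite [RHS]linear_sum scaler_sumr; apply: eq_bigr => i _.
by rewrite [RHS]linearZ scalerA.
Qed.

(** Waring's formula with s = 'X, t = 1, N = n - 2k. Here s + t is the symbol of 1 and s t is half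
    that of the square, which explains (-1/2)^i and 1/2^k. *)
Lemma pair_odd k : (2 * k < n)%N -> odd n ->
  'C(n, k)%:R * (n - 2 * k)%:R / 2 ^+ k *:
     \sum_(0 <= i < ((n.-1)./2 - k).+1)
        ((- 2^-1) ^+ i * 'C(n - 2 * k - i, i)%:R / (n - 2 * k - i)%:R *:
           sy (ttens (tone (n - 2 * k - 2 * i)) (tpow tsq (k + i) (2 * (k + i))) : talg C n))
  = Pw C n k + Pw C n (n - k).
Proof.
move=> kn on; rewrite -Psi_pair; last by lia.
set N := (n - 2 * k)%N; have N0 : (0 < N)%N by rewrite /N; lia.
set B := ((n.-1)./2 - k).+1.
have hB (i : 'I_B) : (2 * i <= N)%N by have := ltn_ord i; rewrite /N /B; lia.
have -> : 'X^N + 1 = \sum_(i < B) wterm 'X 1 N i :> {poly C}.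
  by rewrite waring ?expr1n // /N /B; lia.
rewrite big_mkord; under eq_bigr => i _.
  rewrite (@symb_sy _ ((1 + 'X) ^+ (N - 2 * i) * (2 *: 'X) ^+ (k + i))); last first.
    apply: symb_ttens (symb_tone _ _) (symb_tpow (symb_tsq _) _); last by rewrite mulnC.
    by have := hB i; rewrite /N; lia.
  over.
rewrite PsiZsum; congr Psi; rewrite mulr_sumr scaler_sumr; apply: eq_bigr => i _.
rewrite /wterm hB mulr1 [1 + 'X]addrC exprZn -[- 'X]scaleN1r exprZn -[(wco N i)%:R]scaler_nat.
rewrite wcoE // -!scalerAr -!scalerAl -!scalerAr !scalerA mul1r ['X^k * _]mulrA -exprD.
rewrite [('X + 1) ^+ _ * _]mulrC; congr (_ *: _).
have two0 : 2 ^+ k != 0 :> C by rewrite expf_neq0 // pnatr_eq0.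
have two0' : 2 ^+ i != 0 :> C by rewrite expf_neq0 // pnatr_eq0.
have D0 : (N - i)%:R != 0 :> C by rewrite pnatr_eq0; have := hB i; lia.
rewrite -[- 2^-1]mulN1r exprMn exprVn exprD.
move: (_ ^+ i) (2 ^+ i) two0' (2 ^+ k) two0 (_%:R) D0 => s y y0 x x0 D D0.
by field; rewrite D0 x0 y0.
Qed.

(** Waring's formula with s = 'X^2, t = 1, N = n/2 - k. Now s + t is the symbol of the complement 1
    - square, and s t = (2 'X)^2 / 4 uses two squares, whence (-1/4)^i. *)
Lemma pair_even k : (2 * k < n)%N -> ~~ odd n ->
  'C(n, k)%:R * (n./2 - k)%:R / 2 ^+ k *:
     \sum_(0 <= i < ((n./2 - k)./2).+1)
        ((- 4^-1) ^+ i * 'C(n./2 - k - i, i)%:R / (n./2 - k - i)%:R *: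
           sy (ttens (tpow tsq (k + 2 * i) (2 * (k + 2 * i)))
                     (tpow (tone 2 - tsq) (n./2 - k - 2 * i) (2 * (n./2 - k - 2 * i)))
               : talg C n))
  = Pw C n k + Pw C n (n - k).
Proof.
move=> kn en; rewrite -Psi_pair; last by lia.
set N := (n./2 - k)%N; have N0 : (0 < N)%N by rewrite /N; lia.
set B := (N./2).+1.
have hB (i : 'I_B) : (2 * i <= N)%N by have := ltn_ord i; rewrite /B; lia.
have -> : 'X^(n - 2 * k) + 1 = \sum_(i < B) wterm ('X ^+ 2) 1 N i :> {poly C}.
  rewrite waring // ?expr1n; last by rewrite /B; lia.
  by rewrite -exprM; congr ('X^_ + 1); rewrite /N; lia.
rewrite big_mkord; under eq_bigr => i _.
  rewrite (@symb_sy _ ((2 *: 'X) ^+ (k + 2 * i) * (1 + 'X ^+ 2) ^+ (N - 2 * i))); last first.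
    apply: symb_ttens (symb_tpow (symb_tsq _) _) (symb_tpow (symb_cotsq _) _); rewrite 1?mulnC //.
    by have := hB i; rewrite /N; lia.
  over.
rewrite PsiZsum; congr Psi; rewrite mulr_sumr scaler_sumr; apply: eq_bigr => i _.
rewrite /wterm hB mulr1 [1 + 'X ^+ 2]addrC exprZn -[- 'X ^+ 2]scaleN1r exprZn.
rewrite -[(wco N i)%:R]scaler_nat wcoE // -!scalerAr -!scalerAl -!scalerAr !scalerA mul1r.
rewrite -exprM ['X^k * _]mulrA -exprD; congr (_ *: _).
have two0 : 2 ^+ k != 0 :> C by rewrite expf_neq0 // pnatr_eq0.
have two0' : 2 ^+ i != 0 :> C by rewrite expf_neq0 // pnatr_eq0.
have D0 : (N - i)%:R != 0 :> C by rewrite pnatr_eq0; have := hB i; lia.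
have four : 4 = 2 * 2 :> C by rewrite -natrM.
rewrite -[- 4^-1]mulN1r exprMn exprVn four exprMn exprD mul2n -addnn exprD.
move: (_ ^+ i) (2 ^+ i) two0' (2 ^+ k) two0 (_%:R) D0 => s y y0 x x0 D D0.
by field; rewrite D0 x0 y0.
Qed.

Lemma middle_even : ~~ odd n ->
  (2^-1) ^+ n./2 * 'C(n, n./2)%:R *: sy (tpow tsq n./2 n : talg C n) = Pw C n n./2.
Proof.
move=> en; have hn : n = (n./2 * 2)%N by lia.
rewrite (symb_sy (symb_tpow (symb_tsq _) hn)) -Psi_single; last by lia.
rewrite -[LHS]linearZ /=; congr Psi; rewrite exprZn scalerA; congr (_ *: _).
rewrite mulrAC -exprMn mulVf ?expr1n ?mul1r // pnatr_eq0 //.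
Qed.

End SymbolAverage.

(** * Complete sets of idempotents *)

Lemma sum_nat_reflect (V : zmodType) (F : nat -> V) n a b : (a <= b)%N -> (b <= n.+1)%N ->
  \sum_(a <= k < b) F (n - k)%N = \sum_(n.+1 - b <= j < n.+1 - a) F j.
Proof.
move=> ab; elim: b ab => [|b IH] ab bn.
  by rewrite !big_geq //; lia.
case: (ltngtP a b.+1) ab => // [ab _|-> _]; last by rewrite !big_geq //; lia.
rewrite big_nat_recr //= IH //; last by lia.
rewrite [RHS]big_ltn; last by lia.
rewrite addrC subSS; congr (_ + _); apply: congr_big_nat => //; lia.
Qed.

Section WeightSums.
Variables (C : numClosedFieldType) (n l : nat).
Hypotheses (n0 : (0 < n)%N) (hl : (uphalf n <= l <= n)%N).
Notation e := (eC C n l).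
Notation P := (@Pw C n).

Let ln : (l <= n)%N. Proof. by case/andP: hl. Qed.
Let nl : (n - l <= l)%N. Proof. by have := hl; rewrite uphalf_half; lia. Qed.

Lemma sum_weights : \sum_(n - l <= k < l.+1) P k * e = e.
Proof.
have z k : (k <= n)%N -> (k < n - l)%N || (l < k)%N -> P k * e = 0.
  by move=> kn h; rewrite -eC_Pw // eC_weight0.
rewrite -[RHS]mul1r -(Pw_sum C n) mulr_suml.
rewrite -(big_mkord xpredT (fun k => P k * e)) [RHS](big_cat_nat (n := n - l)) //=; last by lia.
have -> : \sum_(0 <= k < n - l) P k * e = 0.
  by rewrite big_nat big1 // => k hk; rewrite z //; lia.
rewrite add0r [RHS](big_cat_nat (n := l.+1)) //=; last by lia.
have -> : \sum_(l.+1 <= k < n.+1) P k * e = 0.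
  by rewrite big_nat big1 // => k hk; rewrite z //; lia.
by rewrite addr0.
Qed.

Lemma sum_pairs b : (n - l <= b)%N -> (b <= n.+1)%N ->
  \sum_(n - l <= k < b) wpair C n l k =
  \sum_(n - l <= k < b) P k * e + \sum_(n.+1 - b <= k < l.+1) P k * e.
Proof.
move=> h1 h2; rewrite /wpair; under eq_bigr => k _ do rewrite mulrDl.
rewrite big_split /=; congr (_ + _).
rewrite (sum_nat_reflect (fun k => P k * e)) //.
by apply: congr_big_nat => //; lia.
Qed.

Lemma sum_pairs_odd : odd n -> \sum_(n - l <= k < (n.-1)./2.+1) wpair C n l k = e.
Proof.
move=> on; have := hl; rewrite uphalf_half => hl'.
rewrite sum_pairs; [|lia|lia].
have -> : (n.+1 - (n.-1)./2.+1 = (n.-1)./2.+1)%N by lia.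
by rewrite -big_cat_nat ?sum_weights //; lia.
Qed.

Lemma sum_pairs_even : ~~ odd n ->
  P n./2 * e + \sum_(n - l <= k < n./2) wpair C n l k = e.
Proof.
move=> en; have := hl; rewrite uphalf_half => hl'.
rewrite sum_pairs; [|lia|lia].
have -> : (n.+1 - n./2 = n./2.+1)%N by lia.
rewrite addrCA -big_ltn; last by lia.
by rewrite -big_cat_nat ?sum_weights //; lia.
Qed.

End WeightSums.

Section PartA.
Variables (C : numClosedFieldType) (n l : nat).
Hypotheses (n0 : (0 < n)%N) (hl : (uphalf n <= l <= n)%N).

(** Stated up to equations on a and b because [qa] and [qac] write the imaginary unit as
    [Complex 0 1], while [qA] and [qB] use 'i. *)
Lemma weight_idempotents (a b : quat C) : a = qA C -> b = qB C ->
  complete_poi l (iota (n - l) (2 * l - n).+1)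
    (fun k => tmul ('C(n, k)%:R *:
                     sym (ptens n (fun m => if (m < k)%N then a else b)))
                   (eid n l)).
Proof.
move=> -> ->.
have ln : (l <= n)%N by case/andP: hl.
have := hl; rewrite uphalf_half => hl'.
have kP k : k \in iota (n - l) (2 * l - n).+1 -> (n - l <= k <= l)%N.
  by rewrite mem_iota; lia.
pose f k : talg C n := Pw C n k * eC C n l.
have fE k : (k <= n)%N -> tmul ('C(n, k)%:R *:
     sym (ptens n (fun m => if (m < k)%N then qA C else qB C))) (eid n l) = f k.
  move=> kn; congr tmul.
  rewrite -[LHS]/('C(n, k)%:R *: sy (ptens n (fun m => if (m < k)%N then qA C else qB C) : talg C n)).
  rewrite -Psi_single // [RHS]linearZ /=; congr (_ *: _).
  apply: (@symb_sy _ _ _ 'X^k); pose s := nseq k true ++ nseq (n - k) false.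
  have -> : ptens n (fun m => if (m < k)%N then qA C else qB C) = bt C n s.
    apply: eq_ptens => m; rewrite nth_cat size_nseq !nth_nseq.
    by case: ltnP => //; rewrite if_same.
  have hk : k = count id s by rewrite count_cat !count_nseq /= mul1n mul0n addn0.
  by rewrite [in 'X^_]hk; apply: symb_bt; rewrite size_cat !size_nseq; lia.
suff : complete_poi l (iota (n - l) (2 * l - n).+1) f.
  move=> [h1 h2 h3 h4 h5]; split => //.
  - move=> i j iI jI; rewrite !fE; [|have := kP _ jI; lia|have := kP _ iI; lia].
    exact: h2.
  - by move=> i iI; rewrite fE; [apply: h3|have := kP _ iI; lia].
  - by move=> i j iI jI; rewrite !fE; [apply: h4|have := kP _ jI; lia|have := kP _ iI; lia].
  - rewrite -[RHS]h5 big_seq [RHS]big_seq; apply: eq_bigr => i iI.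
    by apply: fE; have := kP _ iI; lia.
apply: complete_poi_intro.
- exact: iota_uniq.
- by move=> k /kP hk; apply: prim_weight.
- move=> i j iI jI ij; rewrite /f -mulrA [eC _ _ _ * _]mulrA eC_Pw // -mulrA mulrA.
  by rewrite Pw_orth // mul0r.
- have := sum_weights C n0 hl; rewrite /index_iota.
  by have -> : (l.+1 - (n - l) = (2 * l - n).+1)%N by lia.
Qed.

End PartA.

(** * Descent of the idempotents to the reals *)

Section Descent.
Variables (R : numFieldType) (C : numClosedFieldType) (inc : {rmorphism R -> C}).
Hypothesis conj_inc : forall x, (inc x)^* = inc x.
Variables (n l : nat).
Hypotheses (n0 : (0 < n)%N) (hl : (uphalf n <= l <= n)%N).

Definition complexify (x : talg R n) : talg C n := tmap inc x.

Lemma complexifyM x y : complexify (x * y) = complexify x * complexify y. Proof. exact: tmapM. Qed.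
Lemma complexify_inj : injective complexify. Proof. exact: tmap_inj. Qed.

Lemma cj_complexify x : cj (complexify x) = complexify x.
Proof. by apply/ffunP => w; rewrite !ffunE; apply: conj_inc. Qed.

(** For n odd: the complexification need not be primitive, so it is tested only against idempotents
    fixed by conjugation. *)
Lemma prim_idem_descend (x : talg R n) : inS l x -> complexify x * complexify x = complexify x -> complexify x <> 0 ->
  (forall y : talg C n, inS l y -> cj y = y -> y * y = y -> complexify x * y = y -> y * complexify x = y ->
     y = 0 \/ y = complexify x) ->
  prim_idem l x.
Proof.
move=> Sx xx x0 h; apply: prim_idem_intro => //.
- by apply: complexify_inj; rewrite complexifyM.
- by move=> x00; apply: x0; rewrite x00; apply: tmap0.
move=> y Sy yy xy yx.
have [||||||/complexify_inj ->] := h (complexify y); try by rewrite -?complexifyM ?yy ?xy ?yx.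
- exact: tmap_inS.
- exact: cj_complexify.
- by move=> Ty; left; apply: complexify_inj; rewrite Ty; symmetry; apply: tmap0.
by right.
Qed.

(** For n even: a splitting over R complexifies to a splitting over C. *)
Lemma prim_idem_descend_prim (x : talg R n) : inS l x -> prim_idem l (complexify x) -> prim_idem l x.
Proof.
move=> Sx [_ xx x0 h]; split => //.
- by apply: complexify_inj; rewrite [LHS]complexifyM.
- by move=> x00; apply: x0; rewrite x00; apply: tmap0.
move=> [y [z [[Sy Sz] [iy iz] [y0 z0] [yz zy] xyz]]].
apply: h; exists (complexify y), (complexify z); split.
- by split; apply: tmap_inS.
- by split; apply: tmap_idem.
- by split=> h; [apply: y0 | apply: z0]; apply: complexify_inj; rewrite h; symmetry; apply: tmap0.
- by rewrite -!tmapM yz zy !tmap0.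
- by rewrite xyz; apply: tmapD.
Qed.

Lemma is_symm_inS (s : talg R n) : symm s -> inS l (tmul s (eid n l)).
Proof. by move=> ss; exists s. Qed.

Lemma complexify_eid : complexify (eid n l) = eC C n l. Proof. exact: tmap_eid. Qed.

Definition odd_pair k : talg R n :=
  'C(n, k)%:R * (n - 2 * k)%:R / 2 ^+ k *:
         \sum_(0 <= i < ((n.-1)./2 - k).+1)
            ((- 2^-1) ^+ i * 'C(n - 2 * k - i, i)%:R / (n - 2 * k - i)%:R *:
               sy (ttens (tone (n - 2 * k - 2 * i))
                          (tpow tsq (k + i) (2 * (k + i))) : talg R n)).

Lemma symm_odd_pair k : symm (odd_pair k).
Proof. by apply/symmZ/symm_sum => i _; apply/symmZ/sy_symm. Qed.

Lemma complexify_odd_pair k : (2 * k < n)%N -> odd n -> complexify (odd_pair k) = Pw C n k + Pw C n (n - k).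
Proof.
move=> kn on; rewrite -pair_odd // /complexify /odd_pair tmapZ tmap_sum !fmorph_div !rmorphM !rmorphXn !rmorph_nat.
congr (_ *: _); apply: eq_bigr => i _.
rewrite tmapZ fmorph_div rmorphM rmorphXn rmorphN fmorphV !rmorph_nat; congr (_ *: _).
by rewrite [LHS]tmap_sym tmap_ttens tmap_tone tmap_tpow tmap_tsq.
Qed.

Lemma odd_idempotents : odd n ->
   complete_poi l (iota (n - l) ((n.-1)./2.+1 - (n - l))) (fun k => tmul (odd_pair k) (eid n l)).
Proof.
move=> on; have := hl; rewrite uphalf_half => hl'.
pose f k : talg R n := odd_pair k * (eid n l : talg R n).
have kP k : k \in iota (n - l) ((n.-1)./2.+1 - (n - l)) -> (n - l <= k)%N /\ (2 * k < n)%N.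
  by rewrite mem_iota; lia.
have Tf k : (2 * k < n)%N -> complexify (f k) = wpair C n l k.
  by move=> kn; rewrite /f complexifyM complexify_odd_pair // complexify_eid.
apply: (@complete_poi_intro R n l _ _ f).
- exact: iota_uniq.
- move=> k /kP[k1 k2]; apply: prim_idem_descend.
  + exact/is_symm_inS/symm_odd_pair.
  + by rewrite Tf // wpair_idem //; lia.
  + by rewrite Tf //; apply: wpair_neq0 => //; lia.
  + by move=> y Sy cy yy; rewrite Tf //; apply: wpair_corner => //; lia.
- move=> i j /kP[i1 i2] /kP[j1 j2] ij; apply: complexify_inj; rewrite complexifyM !Tf //.
  by rewrite wpair_orth //; [symmetry; apply: tmap0|lia|lia|lia].
- apply: complexify_inj; rewrite complexify_eid /complexify tmap_sum -[RHS](sum_pairs_odd C n0 hl on).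
  rewrite /index_iota big_seq [RHS]big_seq; apply: eq_bigr => k /kP[_ hk].
  exact: Tf.
Qed.

Definition even_pair k : talg R n :=
            ('C(n, k)%:R * (n./2 - k)%:R / 2 ^+ k *:
               \sum_(0 <= i < ((n./2 - k)./2).+1)
                  ((- 4^-1) ^+ i * 'C(n./2 - k - i, i)%:R / (n./2 - k - i)%:R *:
                     sy (ttens (tpow tsq (k + 2 * i) (2 * (k + 2 * i)))
                                (tpow (tone 2 - tsq) (n./2 - k - 2 * i)
                                      (2 * (n./2 - k - 2 * i))) : talg R n))).

Lemma symm_even_pair k : symm (even_pair k).
Proof. by apply/symmZ/symm_sum => i _; apply/symmZ/sy_symm. Qed.

Lemma complexify_even_pair k : (2 * k < n)%N -> ~~ odd n -> complexify (even_pair k) = Pw C n k + Pw C n (n - k).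
Proof.
move=> kn en; rewrite -pair_even // /complexify /even_pair tmapZ tmap_sum !fmorph_div !rmorphM !rmorphXn !rmorph_nat.
congr (_ *: _); apply: eq_bigr => i _.
rewrite tmapZ fmorph_div rmorphM rmorphXn rmorphN fmorphV !rmorph_nat; congr (_ *: _).
by rewrite [LHS]tmap_sym tmap_ttens !tmap_tpow tmapB tmap_tsq tmap_tone.
Qed.

Definition even_middle : talg R n :=
  (2^-1) ^+ n./2 * 'C(n, n./2)%:R *: sy (tpow tsq n./2 n : talg R n).

Lemma complexify_even_middle : ~~ odd n -> complexify even_middle = Pw C n n./2.
Proof.
move=> en; rewrite -middle_even // /complexify /even_middle tmapZ rmorphM rmorphXn fmorphV !rmorph_nat.
by congr (_ *: _); rewrite [LHS]tmap_sym tmap_tpow tmap_tsq.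
Qed.

Definition sign_proj (d : bool) : talg R n :=
  2^-1 *: (1 + (if d then 1 else -1) *: (ptens n (fun _ => qe 2) : talg R n)).

Lemma complexify_sign_proj d : complexify (sign_proj d) = 2^-1 *: (1 + (if d then 1 else -1) *: Jop C n).
Proof.
rewrite /complexify /sign_proj tmapZ tmapD tmap_tone tmapZ tmap_qe fmorphV rmorph_nat.
by case: d; rewrite ?rmorphN rmorph1.
Qed.

Lemma symm_sign_proj d : symm (sign_proj d).
Proof. by apply/symmZ/symmD; [exact: symm1 | apply/symmZ => s; rewrite ptensE tpPT]. Qed.

Lemma even_idempotents : ~~ odd n ->
   complete_poi l
    (None :: [seq Some (k, d) | k <- iota (n - l) (n./2 - (n - l)),
                                 d <- [:: false; true]])
    (fun o => match o with
      | None => tmul even_middle (eid n l)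
      | Some (k, d) => tmul (tmul (even_pair k) (sign_proj d)) (eid n l)
      end).
Proof.
move=> en; have := hl; rewrite uphalf_half => hl'.
pose f (o : option (nat * bool)) : talg R n := match o with
      | None => even_middle * (eid n l : talg R n)
      | Some (k, d) => even_pair k * sign_proj d * (eid n l : talg R n)
      end.
pose sg (d : bool) : C := if d then 1 else -1.
have sg2 d : sg d * sg d = 1 by case: d; rewrite /sg ?mulr1 // mulrNN mulr1.
set I := None :: _.
have kP k d : Some (k, d) \in I -> (n - l <= k)%N /\ (2 * k < n)%N.
  rewrite inE => /orP[//|/allpairsP[[k' d'] /= [h _ [-> _]]]].
  by move: h; rewrite mem_iota; lia.
have TfN : complexify (f None) = Pw C n n./2 * eC C n l by rewrite /f complexifyM complexify_even_middle // complexify_eid.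
have TfS k d : (2 * k < n)%N -> complexify (f (Some (k, d))) = signed_pair n l k (sg d).
  by move=> kn; rewrite /f !complexifyM complexify_even_pair // complexify_eid complexify_sign_proj.
apply: (@complete_poi_intro R n l _ _ f).
- rewrite /I cons_uniq allpairs_uniq ?iota_uniq //; last by move=> [k d] [k' d'] _ _ [-> ->].
  by rewrite andbT; apply/negP => /allpairsP[[k d] [_ _]].
- move=> [[k d]|] oI; apply: prim_idem_descend_prim.
  + by apply/is_symm_inS/symmM; [apply: symm_even_pair | apply: symm_sign_proj].
  + have [k1 k2] := kP _ _ oI; rewrite TfS //; apply: signed_pair_prim => //; lia.
  + by apply/is_symm_inS/symmZ/sy_symm.
  + by rewrite TfN; apply: prim_weight => //; lia.
- move=> [[i c]|] [[j d]|] oI oJ ne //; apply: complexify_inj; rewrite complexifyM [RHS]tmap0.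
  + have [i1 i2] := kP _ _ oI; have [j1 j2] := kP _ _ oJ.
    rewrite (TfS i c i2) (TfS j d j2).
    have [ij|ij] := eqVneq i j; last by apply: signed_pair_orth => //; lia.
    rewrite -ij; have -> : sg d = - sg c; last by apply: signed_pair_opp => //; lia.
    by move: ne; rewrite ij; case: c {oI}; case: d {oJ}; rewrite ?eqxx // /sg opprK.
  + have [i1 i2] := kP _ _ oI; rewrite TfS // TfN.
    by have [] := @signed_pair_mid C n n0 l hl i (sg c) n./2; try lia.
  + have [j1 j2] := kP _ _ oJ; rewrite TfS // TfN.
    by have [] := @signed_pair_mid C n n0 l hl j (sg d) n./2; try lia.
- apply: complexify_inj; rewrite complexify_eid /complexify tmap_sum big_cons -/(complexify _) TfN.
  rewrite -[RHS](sum_pairs_even C n0 hl en); congr (_ + _).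
  rewrite big_allpairs_dep /index_iota big_seq [RHS]big_seq; apply: eq_bigr => k.
  rewrite mem_iota => hk; have kn : (2 * k < n)%N by lia.
  by rewrite big_cons big_seq1 -signed_pair_sum -(TfS k false kn) -(TfS k true kn).
Qed.

End Descent.

Theorem theoremA (R : realType) (n l : nat) :
  (0 < n)%N -> (uphalf n <= l <= n)%N ->
  (* (a) *)
  complete_poi l (iota (n - l) (2 * l - n).+1)
    (fun k => tmul ('C(n, k)%:R *:
                     sym (ptens n (fun m => if (m < k)%N then qa R else qac R)))
                   (eid n l))
  /\
  (* (b) *)
  (odd n ->
   complete_poi l (iota (n - l) ((n.-1)./2.+1 - (n - l)))
    (fun k => tmul
      ('C(n, k)%:R * (n - 2 * k)%:R / 2 ^+ k *:
         \sum_(0 <= i < ((n.-1)./2 - k).+1)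
            ((- 2^-1) ^+ i * 'C(n - 2 * k - i, i)%:R / (n - 2 * k - i)%:R *:
               sym (ttens (tone (n - 2 * k - 2 * i))
                          (tpow tsq (k + i) (2 * (k + i))))))
      (eid n l) : tens R n))
  /\
  (* (c) *)
  (~~ odd n ->
   complete_poi l
    (None :: [seq Some (k, d) | k <- iota (n - l) (n./2 - (n - l)),
                                 d <- [:: false; true]])
    (fun o => match o with
      | None => tmul ((2^-1) ^+ n./2 * 'C(n, n./2)%:R *:
                        sym (tpow tsq n./2 n)) (eid n l)
      | Some (k, d) =>
          tmul (tmul
            ('C(n, k)%:R * (n./2 - k)%:R / 2 ^+ k *:
               \sum_(0 <= i < ((n./2 - k)./2).+1)
                  ((- 4^-1) ^+ i * 'C(n./2 - k - i, i)%:R / (n./2 - k - i)%:R *: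
                     sym (ttens (tpow tsq (k + 2 * i) (2 * (k + 2 * i)))
                                (tpow (tone 2 - tsq) (n./2 - k - 2 * i)
                                      (2 * (n./2 - k - 2 * i))))))
            (2^-1 *: (tone n + (if d then 1 else -1) *: ptens n (fun _ => qe 2))))
          (eid n l)
      end : tens R n)).
Proof.
move=> n0 hl.
have cr x : ((real_complex R x) ^* = real_complex R x)%R by rewrite -[RHS]conjc_real.
split; [|split].
- by apply: weight_idempotents => //; rewrite /qa /qac complexiE.
- move=> on; exact (odd_idempotents cr n0 hl on).
- move=> en; exact (even_idempotents (real_complex R) n0 hl en).
Qed.
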